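(* (1) The class of all discrete c-regular cyclically ordered abelian groups is the smallest elementary class which contains all finite cyclic groups. (2) The class of all discrete regular cyclically ordered abelian groups is the smallest elementary class which contains all cyclic groups. If $G$ belongs to this class, then either $G$ is a linearly cyclically ordered group which is elementarily equivalent to $\mathbb{Z}$, or $G$ is c-regular and elementarily equivalent to an ultraproduct of finite cyclic groups.
   Context: All groups are abelian, written additively. A cyclically ordered group $(G,R)$ is an abelian group $G$ with a ternary relation $R$ such that: $R(a,b,c)$ implies that $a,b,c$ are pairwise distinct; $R(a,b,c)\Rightarrow R(b,c,a)$; for every $c\in G$, $R(c,\cdot,\cdot)$ defines a linear order on $G\setminus\{c\}$; $R(a,b,c)\Rightarrow R(a+u,b+u,c+u)$. The language of cyclically ordered groups is the language of groups together with $R$; elementary classes and elementary equivalence are taken in this language, and an elementary class is the class of all models of a set of first order sentences. A linearly ordered group $(G,<)$ becomes cyclically ordered by $R(a,b,c)$ iff $a<b<c$ or $b<c<a$ or $c<a<b$; such cyclically ordered groups are called linearly cyclically ordered. In the expression ''elementarily equivalent to $\mathbb{Z}$'', $\mathbb{Z}$ is the linearly cyclically ordered group obtained from its usual order. ''Cyclic groups'' means the cyclically ordered groups generated by one element. The finite ones are the groups $\mathbb{Z}/n\mathbb{Z}$, $n\ge 1$, with the cyclic order given, for representatives $0\le a,b,c<n$, by $R(\bar a,\bar b,\bar c)$ iff $a<b<c$ or $b<c<a$ or $c<a<b$. $G$ is discrete if it is trivial or $G\setminus\{0\}$ has a smallest element for the order $R(0,\cdot,\cdot)$. $R(x_1,\dots,x_m)$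 (with $m\ge3$) means that $R(x_i,x_j,x_k)$ holds for all $1\le i<j<k\le m$. For $n\geq 2$, $(G,R)$ is $n$-regular if for all $x_1,\dots,x_n\in G$ with $R(0,x_1,\dots,x_n,-x_n)$ there is $x\in G$ such that ($R(x_1,nx,x_n)$ or $nx=x_1$ or $nx=x_n$) and $R(0,x,\dots,(n-1)x,x_n)$; it is c-$n$-regular if the same conclusion holds for all $x_1,\dots,x_n\in G$ with $R(0,x_1,\dots,x_n)$. $G$ is regular (resp. c-regular) if it is $n$-regular (resp. c-$n$-regular) for every $n\ge2$.
   Formalization: In (2), ''cyclic groups'' are those generated by their smallest nonzero element, i.e. Z/nZ and linearly ordered Z; with all groups generated by one element (2) is false, since Z embedded in the circle by an irrational rotation is not discrete. *)

(* Defs.v *)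
From mathcomp Require Import all_boot all_order all_algebra.
From mathcomp Require Import boolp classical_sets filter.

Set Implicit Arguments.
Unset Strict Implicit.
Unset Printing Implicit Defensive.

Import GRing.Theory.

Local Open Scope classical_set_scope.

Record cstruct := CStruct {
  carrier :> Type;
  czero : carrier;
  copp : carrier -> carrier;
  cadd : carrier -> carrier -> carrier;
  cyc : carrier -> carrier -> carrier -> Prop }.

Arguments czero {_}.
Arguments copp {_} _.
Arguments cadd {_} _ _.
Arguments cyc {_} _ _ _.

Definition cmul (G : cstruct) (n : nat) (x : G) : G := iter n (cadd x) czero.

Definition isomorphic (G H : cstruct) : Prop :=
  exists f : G -> H,
    [/\ bijective f,
        f czero = czero,
        (forall x, f (copp x) = copp (f x)),
        (forall x y, f (cadd x y) = cadd (f x) (f y)) &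
        (forall x y z, cyc x y z <-> cyc (f x) (f y) (f z))].

Inductive term :=
| Var of nat
| Zero
| Opp of term
| Add of term & term.

(* Variables are de Bruijn indices: [All] binds index 0.  The semantics is
   classical, so the remaining connectives and [exists] are definable. *)
Inductive formula :=
| Eq of term & term
| Cyc of term & term & term
| Bot
| Imp of formula & formula
| All of formula.

Fixpoint closed_term (k : nat) (t : term) : bool :=
  match t with
  | Var n => n < k
  | Zero => true
  | Opp t1 => closed_term k t1
  | Add t1 t2 => closed_term k t1 && closed_term k t2
  end.

Fixpoint closed_formula (k : nat) (f : formula) : bool :=
  match f with
  | Eq t1 t2 => closed_term k t1 && closed_term k t2
  | Cyc t1 t2 t3 => [&& closed_term k t1, closed_term k t2 & closed_term k t3]
  | Bot => true
  | Imp f1 f2 => closed_formula k f1 && closed_formula k f2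
  | All f1 => closed_formula k.+1 f1
  end.

Definition sentence : Type := {f : formula | closed_formula 0 f}.

Definition env_cons (T : Type) (x : T) (e : nat -> T) : nat -> T :=
  fun n => if n is m.+1 then e m else x.

Fixpoint eval (M : cstruct) (e : nat -> M) (t : term) : M :=
  match t with
  | Var n => e n
  | Zero => czero
  | Opp t1 => copp (eval e t1)
  | Add t1 t2 => cadd (eval e t1) (eval e t2)
  end.

Fixpoint holds (M : cstruct) (e : nat -> M) (f : formula) : Prop :=
  match f with
  | Eq t1 t2 => eval e t1 = eval e t2
  | Cyc t1 t2 t3 => cyc (eval e t1) (eval e t2) (eval e t3)
  | Bot => False
  | Imp f1 f2 => holds e f1 -> holds e f2
  | All f1 => forall x : M, holds (env_cons x e) f1
  end.

(* The environment is irrelevant for a sentence; [czero] is a dummy value. *)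
Definition satisfies (M : cstruct) (s : sentence) : Prop :=
  holds (fun _ => czero : M) (val s).

(* Classes of structures are plain predicates: [set cstruct] would force the
   carriers into a universe too small for [zmodType]. *)
Definition elementary (K : cstruct -> Prop) : Prop :=
  exists T : set sentence,
    forall M : cstruct, K M <-> (forall s, T s -> satisfies M s).

Definition elem_equiv (M N : cstruct) : Prop :=
  forall s : sentence, satisfies M s <-> satisfies N s.

(* [K] is the smallest elementary class containing the class [P]. *)
Definition smallest_elementary (K P : cstruct -> Prop) : Prop :=
  [/\ elementary K,
      (forall M, P M -> K M) &
      forall K' : cstruct -> Prop, elementary K' ->
        (forall M, P M -> K' M) -> forall M, K M -> K' M].

Record strict_linear_order (T : Type) (D : set T) (lt : T -> T -> Prop) :
    Prop := StrictLinearOrder {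
  slo_irr : forall x, D x -> ~ lt x x;
  slo_trans : forall x y z, D x -> D y -> D z -> lt x y -> lt y z -> lt x z;
  slo_total : forall x y, D x -> D y -> x <> y -> lt x y \/ lt y x }.

Record cyc_ordered_group (G : cstruct) : Prop := CycOrderedGroup {
  cog_addA : associative (@cadd G);
  cog_addC : commutative (@cadd G);
  cog_add0 : left_id czero (@cadd G);
  cog_addN : left_inverse czero copp (@cadd G);
  cog_neq : forall a b c : G, cyc a b c -> [/\ a <> b, b <> c & a <> c];
  cog_rot : forall a b c : G, cyc a b c -> cyc b c a;
  cog_lin : forall c : G, strict_linear_order [set x | x <> c] (cyc c);
  cog_tr : forall a b c u : G,
    cyc a b c -> cyc (cadd a u) (cadd b u) (cadd c u) }.

Definition cyc_of_lt (T : Type) (lt : T -> T -> Prop) (a b c : T) : Prop :=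
  [\/ lt a b /\ lt b c, lt b c /\ lt c a | lt c a /\ lt a b].

Definition linearly_cyc_ordered (G : cstruct) : Prop :=
  cyc_ordered_group G /\
  exists lt : G -> G -> Prop,
    [/\ strict_linear_order setT lt,
        (forall x y u : G, lt x y -> lt (cadd x u) (cadd y u)) &
        (forall a b c : G, cyc a b c <-> cyc_of_lt lt a b c)].

Definition discrete (G : cstruct) : Prop :=
  (forall x : G, x = czero) \/
  exists e : G, e <> czero /\ forall x : G, x <> czero -> x = e \/ cyc czero e x.

Definition chain (G : cstruct) (s : seq G) : Prop :=
  forall i j k : nat, i < j -> j < k -> k < size s ->
    cyc (nth czero s i) (nth czero s j) (nth czero s k).

(* The conclusion shared by both notions, for the n-tuple (x_1, ..., x_n) with
   x_1 = [head czero s] and x_n = [last czero s]. *)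
Definition n_divides (G : cstruct) (n : nat) (s : n.-tuple G) : Prop :=
  exists x : G,
    [\/ cyc (head czero s) (cmul n x) (last czero s),
        cmul n x = head czero s | cmul n x = last czero s] /\
    chain (rcons [seq cmul k x | k <- iota 0 n] (last czero s)).

Definition n_regular (n : nat) (G : cstruct) : Prop :=
  forall s : n.-tuple G,
    chain (czero :: rcons s (copp (last czero s))) -> n_divides s.

Definition c_n_regular (n : nat) (G : cstruct) : Prop :=
  forall s : n.-tuple G, chain (czero :: s) -> n_divides s.

Definition regular (G : cstruct) : Prop := forall n, 2 <= n -> n_regular n G.

Definition c_regular (G : cstruct) : Prop := forall n, 2 <= n -> c_n_regular n G.

Definition discrete_regular (G : cstruct) : Prop :=
  [/\ cyc_ordered_group G, discrete G & regular G].

Definition discrete_c_regular (G : cstruct) : Prop :=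
  [/\ cyc_ordered_group G, discrete G & c_regular G].

Definition of_zmod (V : zmodType) (lt : V -> V -> Prop) : cstruct :=
  @CStruct V 0%R (@GRing.opp V) (@GRing.add V) (cyc_of_lt lt).

Definition cycZ : cstruct := @of_zmod int (fun a b => (a < b)%R).

(* Z/(m+1)Z; the elements of ['I_m.+1] are the representatives 0, ..., m and
   they are compared as natural numbers. *)
Definition cycZn (m : nat) : cstruct := @of_zmod 'I_m.+1 (fun a b => a < b).

Definition finite_cyclic (G : cstruct) : Prop :=
  exists m : nat, isomorphic G (cycZn m).

(* A cyclic group is generated by one element g, and g is the smallest nonzero
   element for R(0, ., .) (g = 0 if the group is trivial).  These are, up to
   isomorphism, the groups Z/nZ and the linearly cyclically ordered group Z.
   Without the second condition one would also get the dense subgroups of the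
   circle generated by an irrational rotation, which are not discrete, and
   cyclic orders on Z having a nontrivial proper convex subgroup, which can
   be discrete but not regular. *)
Definition cyclic (G : cstruct) : Prop :=
  cyc_ordered_group G /\
  exists g : G,
    (forall x : G, exists k : nat, x = cmul k g \/ x = copp (cmul k g)) /\
    (forall x : G, x <> czero -> x = g \/ cyc czero g x).

Section Ultraproduct.
Variables (I : Type) (U : set_system I) (FU : UltraFilter U).
Variable (F : I -> cstruct).

Let prodF : Type := {classic forall i, F i}.

Definition ultra_rel : rel prodF :=
  fun f g => `[< U [set i | f i = g i] >].

Lemma ultra_rel_refl : reflexive ultra_rel.
Proof. by move=> f; apply/asboolP; apply: filterS filterT => i. Qed.

Lemma ultra_rel_sym : symmetric ultra_rel.
Proof. by move=> f g; apply/asboolP/asboolP; apply: filterS => i. Qed.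

Lemma ultra_rel_trans : transitive ultra_rel.
Proof.
move=> g f h /asboolP fg /asboolP gh; apply/asboolP.
by apply: filterS (filterI fg gh) => i [/= -> ->].
Qed.

Canonical ultra_equiv : equiv_rel prodF :=
  EquivRel ultra_rel ultra_rel_refl ultra_rel_sym ultra_rel_trans.

Local Open Scope quotient_scope.

Definition ultraproduct : cstruct :=
  let Q := {eq_quot ultra_equiv} in
  @CStruct Q
    (\pi_Q (fun i => czero : F i))
    (fun f => \pi_Q (fun i => copp (repr f i)))
    (fun f g => \pi_Q (fun i => cadd (repr f i) (repr g i)))
    (fun f g h => U [set i | cyc (repr f i) (repr g i) (repr h i)]).

End Ultraproduct.

(* Main.v *)
(* A cyclically ordered group G is the quotient of its unwound group M, an
   ordered abelian group, by a positive element z (a full turn), so G is the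
   interval [0, z) of M with addition modulo z.  If G is discrete, then M has a
   least positive element 1, and c-regularity of G makes M a Z-group (a model of
   Presburger arithmetic: M = nM + Z 1 for all n >= 1).  If G is only regular,
   division with remainder is known on [0, z/2]; either some y there has a
   multiple beyond z, and M is still a Z-group, or the elements of [0, z/2] form
   the positive cone of a linear order for which G itself is a Z-group.

   Cooper's elimination of a quantifier in Presburger arithmetic, read as a
   back-and-forth step between two Z-groups, shows that the truth of a sentence
   in G only depends on the signs of a z + b for small integers a, b and on z
   modulo some integer.  These data are realized by some positive integer n, so
   the sentence holds in G iff it holds in Z/nZ. *)

(* Addition in G reduces modulo z, so a term is not a linear expression in its variables. Each
   reduction is however decided by the sign of one integer combination of the variables and z. A
   term of bounded size therefore evaluates to a combination with bounded coefficients, as long as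
   the signs of all such combinations are known.

   This is why the back-and-forth keeps two finite data: the signs of combinations with coefficients
   up to a bound p, and residues modulo p!, which every coefficient up to p divides. A quantifier
   only costs a larger initial bound. The game is played for one sentence at a time, so neither
   saturation nor compactness is called upon: a sentence that holds in all Z/nZ holds in G because
   one suitable n already decides it.

   The unwound group is built by hand from the carry of addition, which tells whether a sum passes
   0. That this is a symmetric 2-cocycle is where the compatibility of the cyclic order with
   addition is used. *)
Require Import Defs.
From mathcomp Require Import all_boot all_order all_algebra.
From mathcomp Require Import boolp classical_sets filter.
From HB Require Import structures.
From mathcomp Require Import ring lra zify.

Set Implicit Arguments.
Unset Strict Implicit.
Unset Printing Implicit Defensive.

Import Order.TTheory GRing.Theory Num.Theory.

Local Open Scope ring_scope.

(** * Linear identities in abelian groups *)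

(* The square-zero extension Z (+) V: embedding V additively in a commutative
   ring makes the tactic [ring] prove Z-linear identities in V. *)
Definition sqzero (V : zmodType) : Type := (int * V)%type.

Section SquareZero.
Variable V : zmodType.
HB.instance Definition _ := GRing.Zmodule.copy (sqzero V) (int * V)%type.

Let one : sqzero V := (1, 0).
Let mul (x y : sqzero V) : sqzero V := (x.1 * y.1, y.2 *~ x.1 + x.2 *~ y.1).

Let mulA : associative mul.
Proof.
move=> [a x] [b y] [c z]; congr pair; rewrite /= ?mulrA //.
rewrite !mulrzDl -!mulrzA addrA. by rewrite (mulrC b a) (mulrC c a).
Qed.

Let mulC : commutative mul.
Proof. by move=> [a x] [b y]; congr pair; rewrite /= ?(mulrC a) // addrC. Qed.

Let mul1 : left_id one mul.
Proof. by move=> [a x]; congr pair; rewrite /= ?mul1r // mul0rz addr0. Qed.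

Let mulDl : left_distributive mul +%R.
Proof.
move=> [a x] [b y] [c z]; congr pair; rewrite /= ?mulrDl //.
by rewrite mulrzDr mulrzDl addrACA.
Qed.

Let one_neq0 : one != 0.
Proof. by []. Qed.

HB.instance Definition _ :=
  GRing.Zmodule_isComNzRing.Build (sqzero V) mulA mulC mul1 mulDl one_neq0.

Definition to_sqzero (x : V) : sqzero V := (0, x).

Lemma to_sqzero_additive : additive to_sqzero.
Proof. by move=> x y; congr pair; rewrite /= ?subrr. Qed.

HB.instance Definition _ :=
  GRing.isZmodMorphism.Build V (sqzero V) to_sqzero to_sqzero_additive.

Lemma to_sqzero_inj : injective to_sqzero. Proof. by move=> x y []. Qed.

End SquareZero.

Ltac zmod := apply: to_sqzero_inj; ring.

Lemma mulrzS (V : zmodType) (x : V) (n : nat) : x *~ n.+1%:Z = x *~ n%:Z + x.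
Proof. by rewrite -addn1 PoszD; zmod. Qed.

(** * Discrete ordered abelian groups *)

Record ordered_group (M : zmodType) (pos : M -> Prop) (one : M) : Prop := {
  pos_asym : forall x, pos x -> ~ pos (- x);
  pos_total : forall x, x <> 0 -> pos x \/ pos (- x);
  posD : forall x y, pos x -> pos y -> pos (x + y);
  pos_one : pos one;
  pos_least : forall x, pos x -> x = one \/ pos (x - one) }.

(** The remainder is an arbitrary integer, so this is membership in the subgroup nM + Z one. *)
Definition divides_mod (M : zmodType) (one : M) (n : int) (x : M) : Prop :=
  exists (q : M) (r : int), x = q *~ n + one *~ r.

Lemma divides_modD (M : zmodType) (one : M) n x y :
  divides_mod one n x -> divides_mod one n y -> divides_mod one n (x + y).
Proof.
by move=> [q [r ->]] [q' [r' ->]]; exists (q + q'), (r + r'); zmod.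
Qed.

Lemma divides_modMz (M : zmodType) (one : M) n x k :
  divides_mod one n x -> divides_mod one n (x *~ k).
Proof. by move=> [q [r ->]]; exists (q *~ k), (r * k); zmod. Qed.

Lemma divides_modN (M : zmodType) (one : M) n x :
  divides_mod one n x -> divides_mod one n (- x).
Proof. by move=> /(@divides_modMz _ _ _ _ (-1)); rewrite mulrN1z. Qed.

Lemma divides_mod_int (M : zmodType) (one : M) n r :
  divides_mod one n (one *~ r).
Proof. by exists 0, r; zmod. Qed.

Definition zgroup (M : zmodType) (pos : M -> Prop) (one : M) : Prop :=
  ordered_group pos one /\ forall n : nat, (0 < n)%N -> forall x, divides_mod one n x.

Section OrderedGroup.
Variables (M : zmodType) (pos : M -> Prop) (one : M).
Hypothesis Mo : ordered_group pos one.

Let asym := pos_asym Mo.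
Let total := pos_total Mo.
Let addpos := posD Mo.

Definition nneg (x : M) : Prop := ~ pos (- x).

Lemma pos_eq (x y : M) : pos x -> x = y -> pos y. Proof. by move=> ? <-. Qed.

Lemma pos0 : ~ pos 0.
Proof. by move=> p; apply: (asym p); rewrite oppr0. Qed.

Lemma nneg0 : nneg 0. Proof. by rewrite /nneg oppr0; apply: pos0. Qed.

Lemma nneg_eq (x y : M) : nneg x -> x = y -> nneg y. Proof. by move=> ? <-. Qed.

Lemma pos_nneg x : pos x -> nneg x. Proof. exact: asym. Qed.

Lemma nnegE x : nneg x -> x = 0 \/ pos x.
Proof. by move=> nx; have [->|/total[]] := pselect (x = 0); [left|right|move/nx]. Qed.

Lemma not_pos x : ~ pos x -> nneg (- x).
Proof. by rewrite /nneg opprK. Qed.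

Lemma pos_or x : pos x \/ nneg (- x).
Proof. by have [?|/not_pos] := pselect (pos x); [left|right]. Qed.

Lemma pos_neq0 x : pos x -> x <> 0. Proof. by move=> + E; rewrite E => /pos0. Qed.

Lemma posDn x y : pos x -> nneg y -> pos (x + y).
Proof. by move=> px /nnegE[->|]; [rewrite addr0|apply: addpos]. Qed.

Lemma nnegD (x y : M) : nneg x -> nneg y -> nneg (x + y).
Proof.
by move=> /nnegE[->|px] ny; [rewrite add0r|apply/pos_nneg/posDn].
Qed.

Lemma nneg_anti x : nneg x -> nneg (- x) -> x = 0.
Proof. by move=> /nnegE[//|] px /(_ ltac:(by rewrite opprK)). Qed.

Lemma posMn x (n : nat) : pos x -> pos (x *~ n.+1%:Z).
Proof.
move=> px; elim: n => [|n IH]; first by rewrite mulr1z.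
by rewrite mulrzS; apply: addpos.
Qed.

Lemma posMz x (k : int) : 0 < k -> pos x -> pos (x *~ k).
Proof. by case: k => [[|n]|n] // _; apply: posMn. Qed.

Lemma nnegMz x (k : int) : 0 <= k -> nneg x -> nneg (x *~ k).
Proof.
rewrite le_eqVlt => /orP[/eqP <- _|k0 /nnegE[->|px]].
- by rewrite mulr0z; apply: nneg0.
- by rewrite mul0rz; apply: nneg0.
- exact/pos_nneg/posMz.
Qed.

Lemma nnegMzp x (k : int) : 0 <= k -> pos x -> nneg (x *~ k).
Proof. by move=> k0 px; apply/nnegMz/pos_nneg. Qed.

Lemma posMzE x (k : int) : 0 < k -> pos (x *~ k) <-> pos x.
Proof.
move=> k0; split; last exact: posMz.
have [//|nx] := pos_or x; have := nnegMz (ltW k0) nx.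
by rewrite /nneg mulNrz opprK.
Qed.

Lemma mulz_inj (k : int) (x y : M) : 0 < k -> x *~ k = y *~ k -> x = y.
Proof.
move=> k0 E; apply/subr0_eq/nneg_anti => /(posMz k0) /pos_neq0; apply;
by rewrite ?mulNrz mulrzBl E subrr ?oppr0.
Qed.

Lemma pos_int (r : int) : pos (one *~ r) <-> 0 < r.
Proof.
split=> [|r0]; last exact: posMz (pos_one Mo).
case: (ltrgtP r 0) => // [r0 p|->]; last by rewrite mulr0z => /pos0.
have : pos (one *~ - r) by apply: posMz (pos_one Mo); rewrite oppr_gt0.
by rewrite mulrNz => /asym; rewrite opprK.
Qed.

Lemma nneg_int (r : int) : nneg (one *~ r) <-> 0 <= r.
Proof.
rewrite /nneg -mulrNz pos_int oppr_gt0; split=> [/negP|].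
  by rewrite -leNgt.
by move=> r0 /(le_lt_trans r0); rewrite ltxx.
Qed.

Lemma pos_ge_one x : pos x -> nneg (x - one).
Proof.
by move=> /(pos_least Mo)[->|/pos_nneg//]; rewrite subrr; apply: nneg0.
Qed.

Lemma between_int (x : M) (n : nat) : nneg x -> nneg (one *~ n - x) ->
  exists2 k : nat, x = one *~ k & (k <= n)%N.
Proof.
elim: n x => [|n IH] x nx nnx.
  exists 0%N => //; rewrite mulr0z; apply: nneg_anti => //.
  by apply: (nneg_eq nnx); rewrite mulr0z sub0r.
have [->|/pos_ge_one px] := nnegE nx; first by exists 0%N.
have [|k Ek kn] := IH _ px.
  by apply: (nneg_eq nnx); rewrite mulrzS; zmod.
exists k.+1 => //.
by rewrite mulrzS -Ek subrK.
Qed.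

(** Write r = q k + j with 0 <= j < k. Then v = x - q one satisfies k v = j one, and a positive v
    would be at least [one], giving k v >= k one. *)
Lemma dvd_int (k : int) (x : M) r : 0 < k -> x *~ k = one *~ r ->
  exists2 r', r = r' * k & x = one *~ r'.
Proof.
move=> k0 E; have k0' : k != 0 by rewrite gt_eqF.
have Er := divz_eq r k; set q := (r %/ k)%Z in Er; set j := (r %% k)%Z in Er.
have j0 : 0 <= j by apply: modz_ge0.
have jk : j < k by apply: ltz_pmod.
have Ev : (x - one *~ q) *~ k = one *~ j.
  by rewrite mulrzBl E Er; zmod.
have [pv|nv] := pos_or (x - one *~ q).
  have := nnegMz (ltW k0) (pos_ge_one pv).
  by rewrite mulrzBl Ev -mulrzBr nneg_int subr_ge0 leNgt jk.
have j0' : j = 0.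
  have := nnegMz (ltW k0) nv; rewrite mulNrz Ev -mulrNz nneg_int oppr_ge0 => jle.
  by apply/eqP; rewrite eq_le jle.
exists q; first by rewrite Er j0' addr0.
by apply: (mulz_inj k0); rewrite E Er j0'; zmod.
Qed.

Lemma exists_max (T : eqType) (f : T -> M) (P : T -> Prop) (s : seq T) t0 :
  t0 \in s -> P t0 ->
  exists t, [/\ t \in s, P t & forall u, u \in s -> P u -> nneg (f t - f u)].
Proof.
elim: s t0 => // a s IH t0 t0s Pt0.
have [[t1 t1s Pt1]|nex] := pselect (exists2 t1, t1 \in s & P t1); last first.
  have Et0 : t0 = a.
    by move: t0s; rewrite inE => /orP[/eqP//|t0s]; case: nex; exists t0.
  exists a; rewrite mem_head -Et0; split=> // u; rewrite inE => /orP[/eqP-> _|us Pu].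
    by rewrite subrr; apply: nneg0.
  by case: nex; exists u.
have [t [ts Pt tmax]] := IH _ t1s Pt1.
have [[Pa lta]|na] := pselect (P a /\ pos (f a - f t)).
  exists a; rewrite mem_head; split=> // u; rewrite inE => /orP[/eqP-> _|us Pu].
    by rewrite subrr; apply: nneg0.
  by apply: (nneg_eq (nnegD (tmax u us Pu) (pos_nneg lta))); zmod.
exists t; rewrite inE ts orbT; split=> // u; rewrite inE => /orP[/eqP-> Pa|]; last exact: tmax.
by apply: (nneg_eq (not_pos (fun p => na (conj Pa p)))); zmod.
Qed.

End OrderedGroup.

(** Reversing the order reduces approximation from above to approximation from below. *)
Lemma ordered_group_opp (M : zmodType) (pos : M -> Prop) (one : M) :
  zgroup pos one -> zgroup (fun x => pos (- x)) (- one).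
Proof.
move=> [Mo Md]; split; first split=> [x|x /(pos_total Mo)|x y|/=|x].
- exact: (pos_asym Mo).
- by rewrite opprK => -[]; [right|left].
- by rewrite opprD; apply: posD Mo _ _.
- by rewrite opprK; apply: pos_one Mo.
- by move=> /(pos_least Mo)[<-|]; [left; rewrite opprK|rewrite opprK opprD; right].
move=> n /Md nd x; have [q [r ->]] := nd x.
by exists q, (- r); zmod.
Qed.

(** * Back-and-forth between Z-groups *)

Definition small_ints (p : nat) : seq int :=
  [seq k%:Z - p%:Z | k <- iota 0 (p + p).+1].

Lemma small_intsP p c : (c \in small_ints p) = (`|c| <= p)%N.
Proof.
apply/mapP/idP => [[k]|cp]; first by rewrite mem_iota => kp ->; lia.
by exists (absz (c + p%:Z)); rewrite ?mem_iota; lia.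
Qed.

(** A list, because Cooper's step takes a maximum over these finitely many combinations. *)
Fixpoint combs (V : zmodType) (p : nat) (s : seq V) : seq V :=
  if s is v :: s' then [seq v *~ c + u | c <- small_ints p, u <- combs p s']
  else [:: 0].

Section Span.
Variable V : zmodType.
Implicit Types (s : seq V) (u v w : V).

Lemma combs_consP p v s w :
  reflect (exists c u, [/\ (`|c| <= p)%N, u \in combs p s & w = v *~ c + u])
          (w \in combs p (v :: s)).
Proof.
apply: (iffP allpairsP) => [[[c u] /= []]|[c [u [cp us ->]]]].
  by rewrite small_intsP => cp us ->; exists c, u.
by exists (c, u); rewrite /= small_intsP.
Qed.

Lemma combs0 p s : 0 \in combs p s.
Proof.
elim: s => [|v s IH]; first by rewrite inE.
by apply/combs_consP; exists 0, 0; rewrite mulr0z addr0.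
Qed.

Lemma combs_leq p q s : (p <= q)%N -> {subset combs p s <= combs q s}.
Proof.
move=> pq; elim: s => // v s IH w /combs_consP[c [u [cp us ->]]].
by apply/combs_consP; exists c, u; split; [apply: leq_trans pq|apply: IH|].
Qed.

Lemma combsD p q s u v :
  u \in combs p s -> v \in combs q s -> u + v \in combs (p + q) s.
Proof.
elim: s u v => [|x s IH] u v.
  by rewrite !inE => /eqP-> /eqP->; rewrite addr0.
move=> /combs_consP[c [u' [cp us ->]]] /combs_consP[d [v' [dq vs ->]]].
apply/combs_consP; exists (c + d), (u' + v'); split; [lia|exact: IH|zmod].
Qed.

Lemma combsMz p s u (k : int) : u \in combs p s -> u *~ k \in combs (p * `|k|) s.
Proof.
elim: s u => [|x s IH] u; first by rewrite !inE => /eqP->; rewrite mul0rz.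
move=> /combs_consP[c [u' [cp us ->]]].
apply/combs_consP; exists (c * k), (u' *~ k); split; [|exact: IH|zmod].
by rewrite abszM leq_mul2r cp orbT.
Qed.

Lemma combsN p s u : u \in combs p s -> - u \in combs p s.
Proof. by move=> /(@combsMz _ _ _ (-1)); rewrite mulrN1z muln1. Qed.

Lemma combsB p q s u v :
  u \in combs p s -> v \in combs q s -> u - v \in combs (p + q) s.
Proof. by move=> us /combsN; apply: combsD. Qed.

Lemma mem_combs s u : u \in s -> u \in combs 1 s.
Proof.
elim: s => // v s IH; rewrite inE => /orP[/eqP->|/IH us]; apply/combs_consP.
  by exists 1, 0; rewrite combs0 addr0.
by exists 0, u; rewrite add0r.
Qed.

End Span.

(* The bound on coefficients needed before one more variable is added. *)
Definition next_bound (p : nat) : nat := p`! * p + p`! * p + p`! * p`!.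

Lemma leq_next_bound p : (p <= next_bound p)%N.
Proof. by rewrite /next_bound; have := fact_gt0 p; nia. Qed.

Definition swap (A B : Type) (w : A * B) : B * A := (w.2, w.1).

(** Working in the product group lets one combination carry both sides. In the second clause a
    single integer remainder serves both components, so they have the same residue modulo p!. As
    [combs] is closed under opposites, equal signs also give equal zeros. *)
Definition akin (M M' : zmodType) (pos : M -> Prop) (pos' : M' -> Prop)
    (one : M) (one' : M') (p : nat) (s : seq (M * M')) : Prop :=
  [/\ (one, one') \in s,
      (forall w, w \in s -> divides_mod (one, one') p`!%:Z w) &
      forall w, w \in combs p s -> pos w.1 <-> pos' w.2].

Lemma fst_mulz (M M' : zmodType) (w : M * M') k : (w *~ k).1 = w.1 *~ k.
Proof. exact: (raddfMz (@fst M M')). Qed.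

Lemma snd_mulz (M M' : zmodType) (w : M * M') k : (w *~ k).2 = w.2 *~ k.
Proof. exact: (raddfMz (@snd M M')). Qed.

Lemma swapMz (M M' : zmodType) (w : M * M') k : swap (w *~ k) = swap w *~ k.
Proof.
rewrite /swap fst_mulz snd_mulz.
by rewrite [RHS]surjective_pairing fst_mulz snd_mulz.
Qed.

Lemma combs_swap (M M' : zmodType) p (s : seq (M * M')) w :
  w \in combs p (map (@swap M M') s) -> swap w \in combs p s.
Proof.
elim: s w => [|v s IH] w; first by rewrite !inE => /eqP->.
move=> /combs_consP[c [u [cp us ->]]]; apply/combs_consP.
exists c, (swap u); split=> //; first exact: IH.
rewrite -[LHS]/(swap (swap v *~ c) + swap u) swapMz; by case: v.
Qed.

Lemma akin_swap (M M' : zmodType) (pos : M -> Prop) (pos' : M' -> Prop)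
    (one : M) (one' : M') p s :
  akin pos pos' one one' p s ->
  akin pos' pos one' one p (map (@swap M M') s).
Proof.
move=> [s1 sd sp]; split=> [|_ /mapP[w /sd[q [r ->]] ->]|w /combs_swap/sp[]] //.
  by apply/mapP; exists (one, one').
exists (swap q), r; rewrite -swapMz -[(one', one)]/(swap (one, one')) -swapMz.
exact: (erefl (swap _)).
Qed.

Lemma akin_leq (M M' : zmodType) (pos : M -> Prop) (pos' : M' -> Prop)
    (one : M) (one' : M') p q s : (p <= q)%N ->
  akin pos pos' one one' q s -> akin pos pos' one one' p s.
Proof.
move=> pq [s1 sd sp]; split=> // w; last by move=> /(combs_leq pq)/sp.
move=> /sd[x [r ->]]; exists (x *~ (q`! %/ p`!)%N), r.
by rewrite -mulrzA -PoszM divnK // (fact_split pq) dvdn_mulr.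
Qed.

Section Approximation.
Variables (T : eqType) (k d : nat).
Hypotheses (k0 : (0 < k)%N) (d0 : (0 < d)%N).

(** A test point of Cooper's procedure: y can replace x in congruences modulo d and in comparisons
    of k x with the values of f, yet k y is within k d of one of these values. *)
Definition approximates (M : zmodType) (pos : M -> Prop) (one : M)
    (f : T -> M) (s : seq T) (x : M) (t : T) (r : int) (y : M) : Prop :=
  [/\ t \in s, (`|r| <= k * d)%N, y *~ k = f t + one *~ r,
      exists q, x = y + q *~ d &
      forall u, u \in s ->
        (pos (x *~ k - f u) <-> pos (y *~ k - f u)) /\
        (pos (f u - x *~ k) <-> pos (f u - y *~ k))].

(** Let f t be the largest value below k x, and subtract from x as many multiples of d as keep k y
    above f t. Then k y lies between f t and k x, where there is no other value of f. *)
Lemma approximate_below (M : zmodType) (pos : M -> Prop) (one : M)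
    (f : T -> M) s x t0 : zgroup pos one ->
  t0 \in s -> pos (x *~ k - f t0) -> (forall t, t \in s -> f t <> x *~ k) ->
  exists t r y, approximates pos one f s x t r y.
Proof.
move=> [Mo Md] t0s t0x neq.
have [t [ts tx tmax]] :=
  exists_max Mo f (P := fun t => pos (x *~ k - f t)) t0s t0x.
have kd0 : (0 < k * d)%N by rewrite muln_gt0 k0.
have kd0' : 0 < (k * d)%:Z by [].
have [q0 [r0 E0]] := Md _ kd0 (x *~ k - f t).
(* Remainders are taken in 1..kd instead of 0..kd-1, so that k y stays strictly above f t. *)
pose j := ((r0 - 1) %/ (k * d)%:Z)%Z; pose r := ((r0 - 1) %% (k * d)%:Z)%Z + 1.
have Er0 : r0 = j * (k * d)%:Z + r.
  by rewrite /r addrA -divz_eq subrK.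
have r1 : 1 <= r by rewrite lerDr modz_ge0 // gt_eqF.
have rkd : r <= (k * d)%:Z by rewrite -ltzD1 ltrD2r ltz_pmod.
pose q := q0 + one *~ j.
have E : x *~ k - f t = q *~ (k * d)%:Z + one *~ r by rewrite E0 Er0 /q; zmod.
(* If q <= -one, then x k - f t <= (r - kd) one <= 0, against the choice of t. *)
have qn : nneg pos q.
  have [/(pos_nneg Mo)//|nq] := pos_or pos q.
  have [Eq|/(pos_ge_one Mo) q1] := nnegE Mo nq.
    by rewrite -[q]opprK Eq oppr0; apply: nneg0 Mo.
  have : nneg pos (- (x *~ k - f t)).
    have r2 : nneg pos (one *~ ((k * d)%:Z - r)).
      by apply/(nneg_int Mo); rewrite subr_ge0.
    apply: (nneg_eq (nnegD Mo (nnegMz Mo (ltW kd0') q1) r2)).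
    by rewrite E; zmod.
  by rewrite /nneg opprK => /(_ tx).
exists t, r, (x - q *~ d).
have Ey : (x - q *~ d) *~ k = f t + one *~ r.
  rewrite mulrzBl -[x *~ k](subrK (f t)) E PoszM; zmod.
split=> // [||u us].
- lia.
- by exists q; zmod.
have ry : pos ((x - q *~ d) *~ k - f t).
  by rewrite Ey addrC addKr; apply/(pos_int Mo); lia.
have yx : nneg pos (x *~ k - (x - q *~ d) *~ k).
  by apply: (nneg_eq (nnegMz Mo (_ : 0 <= (d * k)%:Z) qn)); [|rewrite PoszM; zmod].
have [ux|xu] := pos_or pos (x *~ k - f u).
  have ut := tmax u us ux.
  have uy : pos ((x - q *~ d) *~ k - f u).
    by apply: (pos_eq (posDn Mo ry ut)); zmod.
  by split; split=> // p; exfalso; [apply: (pos_asym Mo ux)|apply: (pos_asym Mo uy)];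
     apply: (pos_eq p); zmod.
have {}xu : pos (f u - x *~ k).
  have [Eu|p] := nnegE Mo xu; last by apply: (pos_eq p); zmod.
  by case: (neq u us); apply/esym/subr0_eq; rewrite -[LHS]opprK Eu oppr0.
have yu : pos (f u - (x - q *~ d) *~ k).
  by apply: (pos_eq (posDn Mo xu yx)); zmod.
by split; split=> // p; exfalso; [apply: (pos_asym Mo xu)|apply: (pos_asym Mo yu)];
   apply: (pos_eq p); zmod.
Qed.

Lemma approximate (M : zmodType) (pos : M -> Prop) (one : M)
    (f : T -> M) s x t0 : zgroup pos one -> t0 \in s ->
  exists t r y, approximates pos one f s x t r y.
Proof.
move=> Mz t0s; have Mo := Mz.1.
have [[t ts Et]|neq] := pselect (exists2 t, t \in s & f t = x *~ k).
  exists t, 0, x; split=> //; first by rewrite mulr0z addr0.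
  by exists 0; rewrite mul0rz addr0.
have {}neq t : t \in s -> f t <> x *~ k by move=> ts Et; apply: neq; exists t.
have [/subr0_eq/esym/(neq t0 t0s)//|] := pselect (x *~ k - f t0 = 0).
move=> /(pos_total Mo)[|xt]; first by move=> p; apply: (approximate_below Mz t0s).
have Mz' := ordered_group_opp Mz.
have [t [r [y [ts rkd Ey q cut]]]] :=
  approximate_below (ordered_group_opp Mz) t0s xt neq.
exists t, (- r), y; split=> // [||u /cut[]].
- by rewrite abszN.
- by rewrite Ey; zmod.
by rewrite !opprB.
Qed.

End Approximation.

(* With L = p!, the sign conditions on x compare L x with finitely many
   combinations u of s.  Replacing x by an element of its class modulo L, L x
   becomes t + r 1 with t one of these u and |r| <= L^2; the element y is then
   read off the same expression in M', whose divisibility by L is known from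
   the residues of s. *)
Lemma akin_forth (M M' : zmodType) (pos : M -> Prop) (pos' : M' -> Prop)
    (one : M) (one' : M') p s (x : M) :
  zgroup pos one -> zgroup pos' one' ->
  akin pos pos' one one' (next_bound p) s ->
  exists y : M', akin pos pos' one one' p ((x, y) :: s).
Proof.
move=> Mz [M'o _] [s1 sd sp]; have Mo := Mz.1.
set L := p`!; set N := next_bound p; set F := N`!.
have L0 : (0 < L)%N by apply: fact_gt0.
(* One factor L is used up in dividing by L to obtain x' and y; the other gives the residue of the
   new pair modulo L. *)
have LLF : (L * L %| F)%N.
  by apply: dvdn_fact; rewrite muln_gt0 L0 /= /N /next_bound -/L leq_addl.
pose one2 := (one, one').
have [t [r [x' [ts rkd Ex' [q0 Ex] cut]]]] :=
  approximate L0 L0 fst x Mz (combs0 (L * p) s).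
have combs_dvd w n : w \in combs n s -> divides_mod one2 F%:Z w.
  elim: (s) sd w => [|v s' IH] sd' w; first by rewrite inE => /eqP->; exists 0, 0; zmod.
  move=> /combs_consP[c [u [_ us ->]]]; apply: divides_modD.
    by apply/divides_modMz/sd'; rewrite mem_head.
  by apply: IH us => v' v's; apply: sd'; rewrite inE v's orbT.
have [q [r' Et]] : divides_mod one2 F%:Z (t + one2 *~ r).
  by apply: divides_modD (combs_dvd _ _ ts) (divides_mod_int _ _ _).
have EF : F%:Z = (F %/ L)%:Z * L%:Z.
  by rewrite -PoszM divnK // (dvdn_trans _ LLF) // dvdn_mulr.
have L0' : 0 < L%:Z by [].
have E1 : x' *~ L = q.1 *~ F + one *~ r'.
  by rewrite Ex' -[one]/(one2.1) -!fst_mulz -[RHS]/((q *~ F + one2 *~ r').1) -Et.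
(* The element x' of M witnesses that L divides r'. This is a fact about integers, so it can be used
   in M' to define y. *)
have [r2 Er' Er2] : exists2 r2, r' = r2 * L%:Z & x' - q.1 *~ (F %/ L)%N = one *~ r2.
  by apply: (dvd_int Mo L0'); rewrite mulrzBl E1 EF; zmod.
pose y := q.2 *~ (F %/ L)%N + one' *~ r2.
have Ey : y *~ L = t.2 + one' *~ r.
  rewrite -[one' in RHS]/(one2.2) -snd_mulz -[RHS]/((t + one2 *~ r).2) Et.
  by rewrite -[RHS]/((q *~ F).2 + (one2 *~ r').2) !snd_mulz /y EF Er'; zmod.
have Exy : (x', y) *~ L = t + one2 *~ r.
  rewrite [LHS]surjective_pairing fst_mulz snd_mulz /= Ex' Ey.
  rewrite [RHS]surjective_pairing -[(t + _).1]/(t.1 + (one2 *~ r).1).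
  by rewrite -[(t + _).2]/(t.2 + (one2 *~ r).2) fst_mulz snd_mulz.
(* Multiplication by k = L / c turns c x + u into L x + k u, which compares L x with the listed
   combination - k u. *)
have sign c u : u \in combs p s -> 0 < c -> (`|c| <= p)%N ->
    (pos (x *~ c + u.1) <-> pos' (y *~ c + u.2)) /\
    (pos (- (x *~ c + u.1)) <-> pos' (- (y *~ c + u.2))).
  move=> us c0 cp.
  have [k Ek] : exists k : nat, (k * absz c)%N = L.
    have /dvdnP[k ->] : (absz c %| L)%N by apply: dvdn_fact; lia.
    by exists k.
  have k0 : 0 < k%:Z by nia.
  have Ek' : L%:Z = c * k%:Z by nia.
  have uT : (- u) *~ k \in combs (L * p) s.
    by apply: (combs_leq _ (combsMz k (combsN us))); rewrite mulnC leq_mul2r absz_nat; nia.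
  have ds : (t + one2 *~ r) - (- u) *~ k \in combs N s.
    (* The three summands of [next_bound] bound the coefficients of t, of k u, and of r one. *)
    apply: (@combs_leq _ (L * p + 1 * `|r| + L * p)); last first.
      by apply: combsB uT; apply/combsD/combsMz/mem_combs.
    by rewrite /N /next_bound -/L mul1n addnAC leq_add2l.
  have [cut1 cut2] := cut _ uT.
  have [sp1 sp2] := (sp _ ds, sp _ (combsN ds)).
  have X1 : (x *~ c + u.1) *~ k = x *~ L - ((- u) *~ k).1.
    by rewrite fst_mulz Ek' -[(- u).1]/(- u.1); zmod.
  have X2 : x' *~ L - ((- u) *~ k).1 = (t + one2 *~ r - - u *~ k).1.
    by rewrite -Exy -[RHS]/(((x', y) *~ L).1 - (- u *~ k).1) !fst_mulz.
  have X3 : (y *~ c + u.2) *~ k = (t + one2 *~ r - - u *~ k).2.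
    rewrite -Exy -[RHS]/(((x', y) *~ L).2 - (- u *~ k).2) !snd_mulz /=.
    by rewrite Ek'; zmod.
  split.
    by rewrite -(posMzE Mo _ k0) X1 cut1 X2 sp1 -X3 (posMzE M'o).
  rewrite -(posMzE Mo _ k0) mulNrz X1 opprB cut2 -opprB X2.
  rewrite -[- _.1]/((- (t + one2 *~ r - - u *~ k)).1) sp2.
  by rewrite -(posMzE M'o (- (y *~ c + u.2)) k0) [- (y *~ c + _) *~ _]mulNrz X3.
exists y; split; first by rewrite inE s1 orbT.
  move=> w; rewrite inE => /orP[/eqP->|ws]; last first.
    have [q' [j ->]] := sd w ws; exists (q' *~ (F %/ L)%N), j.
    by rewrite -mulrzA -EF.
  (* Only the first component has to be corrected: (x, y) = (x', y) + L (q0, 0), and y was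
     constructed from x'. *)
  exists ((q0, 0) + q *~ (F %/ L %/ L)%N), r2.
  have -> : (x, y) = (x', y) + (q0, 0) *~ L.
    rewrite -[(q0, 0) *~ L](_ : (q0 *~ L, 0) = _) ?Ex.
      by rewrite -[RHS]/(x' + q0 *~ L, y + 0) addr0.
    by rewrite [RHS]surjective_pairing fst_mulz snd_mulz /= mul0rz.
  have -> : (x', y) = q *~ (F %/ L)%N + one2 *~ r2.
    rewrite [RHS]surjective_pairing.
    rewrite -[(q *~ _ + _).1]/((q *~ (F %/ L)%N).1 + (one2 *~ r2).1) !fst_mulz.
    rewrite -[(q *~ _ + _).2]/((q *~ (F %/ L)%N).2 + (one2 *~ r2).2) !snd_mulz /=.
    by congr pair; rewrite -Er2; zmod.
  have -> : (F %/ L)%:Z = (F %/ L %/ L)%:Z * L%:Z.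
    have LF : (L %| F)%N by rewrite (dvdn_trans _ LLF) // dvdn_mulr.
    by rewrite -PoszM divnK // dvdn_divRL.
  zmod.
move=> w /combs_consP[c [u [cp us ->]]].
rewrite -[(_ + u).1]/(((x, y) *~ c).1 + u.1) -[(_ + u).2]/(((x, y) *~ c).2 + u.2).
rewrite fst_mulz snd_mulz /=.
case: (ltrgtP c 0) => [c0|c0|->].
- have [||_] := sign (- c) (- u) (combsN us); [lia|lia|].
  by rewrite -[(- u).1]/(- u.1) -[(- u).2]/(- u.2) !mulrNz -!opprD !opprK.
- by have [] := sign c u us c0 cp.
- by rewrite !mulr0z !add0r; apply: sp; apply: combs_leq us; apply: leq_next_bound.
Qed.

(** * Charts and transfer of sentences *)

(* G is identified through [rep] with the interval [0, z) of M with addition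
   modulo z; the junk value z = 0 means that G is identified with M itself. *)
Definition in_range (M : zmodType) (pos : M -> Prop) (z x : M) : Prop :=
  z = 0 \/ nneg pos x /\ pos (z - x).

Record chart (G : cstruct) (M : zmodType) (pos : M -> Prop) (z : M)
    (rep : G -> M) : Prop := {
  chart_inj : injective rep;
  chart_range : forall g, in_range pos z (rep g);
  chart_surj : forall x, in_range pos z x -> exists g, rep g = x;
  chart0 : rep czero = 0;
  chart_opp : forall g, rep (copp g) = - rep g \/ rep (copp g) = z - rep g;
  chart_add : forall g h, rep (cadd g h) = rep g + rep h \/
                          rep (cadd g h) = rep g + rep h - z;
  chart_cyc : forall a b c, cyc a b c <->
    cyc_of_lt (fun g h => pos (rep h - rep g)) a b c }.

Section Chart.
Variables (G : cstruct) (M : zmodType) (pos : M -> Prop) (one z : M).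
Variable rep : G -> M.
Hypotheses (Mo : ordered_group pos one) (Gc : chart pos z rep).

(** The range decides between the alternatives of [chart_add], so addition becomes a case
    distinction on one sign. For z = 0 the two branches coincide. *)
Lemma chart_addE g h : rep (cadd g h) =
  if `[< pos (z - (rep g + rep h)) >] then rep g + rep h else rep g + rep h - z.
Proof.
have [z0|[ge0 ltz]] := chart_range Gc (cadd g h).
  by have := chart_add Gc g h; rewrite z0 subr0 if_same => -[].
case: asboolP => p; have [E|E] // := chart_add Gc g h.
- by case: ge0; rewrite E opprB.
- by case: p; rewrite -E.
Qed.

Lemma chart_oppE g : rep (copp g) =
  if `[< pos (rep g) >] then z - rep g else - rep g.
Proof.
have [z0|[ge0 ltz]] := chart_range Gc (copp g).
  by have := chart_opp Gc g; rewrite z0 sub0r if_same => -[].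
case: asboolP => p; have [E|E] // := chart_opp Gc g.
- by case: ge0; rewrite E opprK.
- have [z0|[/(nnegE Mo)[g0|//] _]] := chart_range Gc g; first by rewrite E z0 sub0r.
  by move: ltz; rewrite E g0 subr0 subrr => /(pos0 Mo).
Qed.

End Chart.

(** A coefficient bound for the value of a term: each [Opp] or [Add] may add or subtract z once
    more, hence the successors. *)
Fixpoint term_size (t : term) : nat :=
  match t with
  | Var _ => 1
  | Zero => 0
  | Opp t1 => (term_size t1).+1
  | Add t1 t2 => (term_size t1 + term_size t2).+1
  end.

(** The successor under [All] guarantees a coefficient bound of at least 1, needed to see that the
    answer to a move again lies in the range of the chart. *)
Fixpoint rank (f : formula) : nat :=
  match f with
  | Eq t1 t2 => term_size t1 + term_size t2
  | Cyc t1 t2 t3 => term_size t1 + term_size t2 + term_size t3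
  | Bot => 0
  | Imp f1 f2 => maxn (rank f1) (rank f2)
  | All f1 => next_bound (rank f1).+1
  end.

Section Signs.
Variables (M M' : zmodType) (pos : M -> Prop) (pos' : M' -> Prop).
Variables (one : M) (one' : M') (p : nat) (s : seq (M * M')).
Hypotheses (Mo : ordered_group pos one) (M'o : ordered_group pos' one').
Hypothesis sim : akin pos pos' one one' p s.

Lemma akin_nneg w : w \in combs p s -> nneg pos w.1 <-> nneg pos' w.2.
Proof.
by move=> /combsN; case: sim => _ _ sp /sp; rewrite /nneg /= => ->.
Qed.

Lemma akin_eq0 w : w \in combs p s -> w.1 = 0 <-> w.2 = 0.
Proof.
move=> ws; have n1 := akin_nneg ws; have n2 := akin_nneg (combsN ws).
split=> E.
- by apply: (nneg_anti M'o); [apply/n1|apply/n2]; rewrite /= E ?oppr0; apply: nneg0 Mo.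
- by apply: (nneg_anti Mo); [apply/n1|apply/n2]; rewrite /= E ?oppr0; apply: nneg0 M'o.
Qed.

End Signs.

Section Transfer.
Variables (G H : cstruct) (M M' : zmodType).
Variables (pos : M -> Prop) (pos' : M' -> Prop).
Variables (one z : M) (one' z' : M') (rep : G -> M) (rep' : H -> M').
Hypotheses (Mz : zgroup pos one) (M'z : zgroup pos' one').
Hypotheses (Gc : chart pos z rep) (Hc : chart pos' z' rep').

Definition matches (p m : nat) (e : nat -> G) (e' : nat -> H) : Prop :=
  exists s, [/\ akin pos pos' one one' p s, (z, z') \in s &
    forall i, (i < m)%N -> (rep (e i), rep' (e' i)) \in s].

(** Both evaluations take the same branch at every [Opp] and [Add], since the branch depends on the
    sign of a combination of [s]. *)
Lemma eval_combs p m s e e' t :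
  akin pos pos' one one' p s -> (z, z') \in s ->
  (forall i, (i < m)%N -> (rep (e i), rep' (e' i)) \in s) ->
  closed_term m t -> (term_size t <= p)%N ->
  (rep (eval e t), rep' (eval e' t)) \in combs (term_size t) s.
Proof.
move=> sim zs es; have [_ _ sgn] := sim; have [Mo M'o] := (Mz.1, M'z.1).
elim: t => [i|_|t IH|t1 IH1 t2 IH2] /=.
- by move=> im _; apply: mem_combs; apply: es.
- by rewrite (chart0 Gc) (chart0 Hc) => _; apply: (combs0 0 s).
- move=> tm tp; have {IH} ws := IH tm (ltnW tp).
  have := sgn _ (combs_leq (ltnW tp) ws) => /= sg.
  rewrite (chart_oppE Mo Gc) (chart_oppE M'o Hc) -(asbool_equiv_eq sg).
  case: ifP => _; last exact: (combs_leq (leqnSn _) (combsN ws)).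
  by rewrite -add1n; apply: (combsB (mem_combs zs) ws).
- move=> /andP[tm1 tm2] tp.
  have ws1 := IH1 tm1 ltac:(lia); have ws2 := IH2 tm2 ltac:(lia).
  have ws := combsD ws1 ws2.
  have ds := combsB (mem_combs zs) ws.
  have := sgn _ (combs_leq _ ds); rewrite add1n => /(_ tp) /= sg.
  rewrite (chart_addE Gc) (chart_addE Hc) -(asbool_equiv_eq sg).
  case: ifP => _; first exact: (combs_leq (leqnSn _) ws).
  by rewrite -addn1; apply: (combsB ws (mem_combs zs)).
Qed.

Lemma matches_leq p q m e e' : (p <= q)%N -> matches q m e e' -> matches p m e e'.
Proof. by move=> pq [s [/(akin_leq pq) ? ? ?]]; exists s. Qed.

Lemma matches_forth p m e e' x : matches (next_bound p.+1) m e e' ->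
  exists y, matches p m.+1 (env_cons x e) (env_cons y e').
Proof.
move=> [s [sim zs es]]; have [Mo M'o] := (Mz.1, M'z.1).
have [y' sim'] := akin_forth (rep x) Mz M'z sim.
have xs : (rep x, y') \in combs p.+1 ((rep x, y') :: s).
  by apply: (@combs_leq _ 1) => //; apply: mem_combs; rewrite mem_head.
have zs' : (z, z') \in combs p.+1 ((rep x, y') :: s).
  by apply: (@combs_leq _ 1) => //; apply: mem_combs; rewrite inE zs orbT.
have zxs : (z, z') - (rep x, y') \in combs p.+1 ((rep x, y') :: s).
  apply/combs_consP; exists (-1), (z, z'); split=> //.
    by apply: (@combs_leq _ 1) => //; apply: mem_combs.
  by zmod.
(* Being in range is expressed by the vanishing of z and the signs of x and z - x, all preserved by
   [akin]. *)
have [|y Ey] := chart_surj Hc (x := y').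
  have [z0|[x0 xz]] := chart_range Gc x.
    by left; apply/(akin_eq0 Mo M'o sim' zs').
  right; split; first exact/(akin_nneg sim' xs).
  by have [_ _ /(_ _ zxs)[/(_ xz)]] := sim'.
exists y, ((rep x, y') :: s); split=> [|| [|i]] /=.
- exact: akin_leq sim'.
- by rewrite inE zs orbT.
- by rewrite Ey mem_head.
- by move=> im; rewrite inE es ?orbT.
Qed.

End Transfer.

Lemma matches_swap (G H : cstruct) (M M' : zmodType) (pos : M -> Prop)
    (pos' : M' -> Prop) (one z : M) (one' z' : M') (rep : G -> M)
    (rep' : H -> M') p m e e' :
  matches pos pos' one z one' z' rep rep' p m e e' ->
  matches pos' pos one' z' one z rep' rep p m e' e.
Proof.
move=> [s [/akin_swap sim zs es]]; exists (map (@swap M M') s); split=> //.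
  by apply/mapP; exists (z, z').
by move=> i /es im; apply/mapP; exists (rep (e i), rep' (e' i)).
Qed.

Lemma holds_matches (G H : cstruct) (M M' : zmodType) (pos : M -> Prop)
    (pos' : M' -> Prop) (one z : M) (one' z' : M') (rep : G -> M)
    (rep' : H -> M') (f : formula) m e e' :
  zgroup pos one -> zgroup pos' one' -> chart pos z rep -> chart pos' z' rep' ->
  closed_formula m f ->
  matches pos pos' one z one' z' rep rep' (rank f) m e e' ->
  holds e f <-> holds e' f.
Proof.
move=> Mz M'z Gc Hc; have [Mo M'o] := (Mz.1, M'z.1).
elim: f m e e' => [t1 t2|t1 t2 t3||f1 IH1 f2 IH2|f IH] m e e' //=.
- move=> /andP[c1 c2] [s [sim zs es]].
  have w1 := eval_combs Mz M'z Gc Hc sim zs es c1 (leq_addr _ _).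
  have w2 := eval_combs Mz M'z Gc Hc sim zs es c2 (leq_addl _ _).
  have := akin_eq0 Mo M'o sim (combsB w1 w2) => /= E.
  split=> [Et|Et]; [apply: (chart_inj Hc)|apply: (chart_inj Gc)];
    by apply/subr0_eq/E; rewrite Et subrr.
- move=> /and3P[c1 c2 c3] [s [sim zs es]].
  have w1 := eval_combs Mz M'z Gc Hc sim zs es c1 ltac:(lia).
  have w2 := eval_combs Mz M'z Gc Hc sim zs es c2 ltac:(lia).
  have w3 := eval_combs Mz M'z Gc Hc sim zs es c3 ltac:(lia).
  have [_ _ sgn] := sim.
  have sgnB u v w w' i j : (i + j <= rank (Cyc t1 t2 t3))%N ->
      (u, w) \in combs i s -> (v, w') \in combs j s -> pos (u - v) = pos' (w - w').
    by move=> ij us vs; apply/propext/(sgn _ (combs_leq ij (combsB us vs))).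
  rewrite (chart_cyc Gc) (chart_cyc Hc) /cyc_of_lt.
  by rewrite (sgnB _ _ _ _ _ _ _ w2 w1) ?(sgnB _ _ _ _ _ _ _ w3 w2)
             ?(sgnB _ _ _ _ _ _ _ w1 w3) //=; lia.
- move=> /andP[c1 c2] ma.
  have -> := IH1 _ _ _ c1 (matches_leq (leq_maxl _ _) ma).
  by have -> := IH2 _ _ _ c2 (matches_leq (leq_maxr _ _) ma).
- move=> c ma; split=> hf x.
  + have [y ma'] := matches_forth M'z Mz Hc Gc x (matches_swap ma).
    by apply/(IH _ _ _ c (matches_swap ma')).
  + have [y ma'] := matches_forth Mz M'z Gc Hc x ma.
    by apply/(IH _ _ _ c ma').
Qed.

Lemma satisfies_charts (G H : cstruct) (M M' : zmodType) (pos : M -> Prop)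
    (pos' : M' -> Prop) (one z : M) (one' z' : M') (rep : G -> M)
    (rep' : H -> M') (f : sentence) :
  zgroup pos one -> zgroup pos' one' -> chart pos z rep -> chart pos' z' rep' ->
  akin pos pos' one one' (rank (val f)) [:: (z, z'); (one, one')] ->
  satisfies G f <-> satisfies H f.
Proof.
move=> Mz M'z Gc Hc sim; apply: (holds_matches Mz M'z Gc Hc (valP f)).
by exists [:: (z, z'); (one, one')]; rewrite mem_head.
Qed.

Lemma akin_one (M M' : zmodType) (pos : M -> Prop) (pos' : M' -> Prop)
    (one : M) (one' : M') p :
  ordered_group pos one -> ordered_group pos' one' ->
  akin pos pos' one one' p [:: (one, one')].
Proof.
move=> Mo M'o; split=> [|w|w]; first by rewrite mem_head.
  by rewrite inE => /eqP->; exists 0, 1; zmod.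
move=> /combs_consP[c [u [_]]]; rewrite inE => /eqP-> ->.
by rewrite addr0 fst_mulz snd_mulz /= (pos_int Mo) (pos_int M'o).
Qed.

(** * The groups Z and Z/nZ *)

Lemma zgroup_int : zgroup (fun x : int => 0 < x) 1.
Proof.
split=> [|n n0 x]; first by split=> *; lia.
exists (x %/ n)%Z, (x %% n)%Z.
by rewrite !mulrzz mul1r -divz_eq.
Qed.

Lemma valD_Zn m (a b : 'I_m.+1) :
  ((a + b)%R = (a + b)%N :> nat /\ (a + b < m.+1)%N) \/
  ((a + b)%R = (a + b - m.+1)%N :> nat /\ (m.+1 <= a + b)%N).
Proof.
rewrite /=; have [|ab] := ltnP (a + b) m.+1; [left|right]; first by rewrite modn_small.
split=> //; rewrite -[in LHS](subnK ab) modnDr modn_small //.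
by have := ltn_ord a; have := ltn_ord b; lia.
Qed.

Lemma chart_cycZn m :
  chart (G := cycZn m) (fun x : int => 0 < x) m.+1%:Z
        (fun i : 'I_m.+1 => Posz i).
Proof.
split=> [i j [/val_inj//]|i|x|//|i|i j|a b c].
- by right; rewrite /nneg; have := ltn_ord i; lia.
- move=> [//|[]]; rewrite /nneg /= => x0 xm.
  have xm' : (absz x < m.+1)%N by lia.
  by exists (Ordinal xm'); rewrite /=; lia.
- have := ltn_ord i; rewrite /= => im.
  have [->|i0] := posnP i; first by left; rewrite subn0 modnn.
  by right; rewrite modn_small ?subzn ?(ltnW im) ?ltn_subrL ?i0.
- by have [[/= -> ?]|[/= -> ?]] := valD_Zn i j; [left|right]; lia.
- by rewrite /= /cyc_of_lt !subr_gt0.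
Qed.

Lemma cyc_of_lt_neq (T : Type) (lt : T -> T -> Prop) a b c :
  (forall x, ~ lt x x) -> (forall x y, lt x y -> ~ lt y x) ->
  cyc_of_lt lt a b c -> [/\ a <> b, b <> c & a <> c].
Proof.
move=> irr asym abc; split=> E; move: abc; rewrite E => -[] [l1 l2];
  by [apply: irr l1|apply: irr l2|apply: asym l1 l2].
Qed.

Lemma cyc_of_lt_rot (T : Type) (lt : T -> T -> Prop) a b c :
  cyc_of_lt lt a b c -> cyc_of_lt lt b c a.
Proof. by move=> [] []; [constructor 3|constructor 1|constructor 2]. Qed.

Lemma cyc_of_lt_lin (T : Type) (lt : T -> T -> Prop) c :
  strict_linear_order setT lt ->
  strict_linear_order [set x | x <> c] (cyc_of_lt lt c).
Proof.
move=> [irr tr tot].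
have {}irr x : ~ lt x x by apply: irr.
have {}tr x y t : lt x y -> lt y t -> lt x t by apply: tr.
have asym x y : lt x y -> ~ lt y x by move=> xy /(tr _ _ _ xy)/irr.
have {}tot x y : x <> y -> lt x y \/ lt y x by apply: tot.
rewrite /cyc_of_lt; split=> [x|x y t|x y] /= xc.
- by move=> [] [l1 l2]; [apply: irr l2|apply: irr l1|apply: asym l1 l2].
- move=> yc tc.
  by move=> [] [l1 l2] [] [l3 l4];
    first [constructor 1; split; by eauto | constructor 2; split; by eauto
          |constructor 3; split; by eauto | case: (irr c); by eauto
          |case: (irr x); by eauto | case: (irr t); by eauto].
- move=> yc xy.
  by have [l1|l1] := tot _ _ xc; have [l2|l2] := tot _ _ yc; have [l3|l3] := tot _ _ xy;
    first [left; constructor 1; by split | left; constructor 2; by split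
          |left; constructor 3; by split | right; constructor 1; by split
          |right; constructor 2; by split | right; constructor 3; by split].
Qed.

Lemma strict_linear_asym (T : Type) (lt : T -> T -> Prop) :
  strict_linear_order setT lt -> forall x y, lt x y -> ~ lt y x.
Proof.
by move=> lto x y xy yx; apply: (slo_irr lto (x := x)) => //; apply: (slo_trans lto) yx.
Qed.

Lemma cyc_ordered_of_zmod (V : zmodType) (lt : V -> V -> Prop) :
  strict_linear_order setT lt ->
  (forall a b c u, cyc_of_lt lt a b c -> cyc_of_lt lt (a + u) (b + u) (c + u)) ->
  cyc_ordered_group (of_zmod lt).
Proof.
move=> lto tr; split=> //=.
- exact: addrA.
- exact: addrC.
- exact: add0r.
- exact: addNr.
- move=> a b c; apply: cyc_of_lt_neq => [x|]; first exact: (slo_irr lto).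
  exact: strict_linear_asym.
- exact: cyc_of_lt_rot.
- by move=> c; apply: cyc_of_lt_lin.
Qed.

Lemma cyc_ordered_cycZn m : cyc_ordered_group (cycZn m).
Proof.
apply: cyc_ordered_of_zmod => [|a b c u].
  split=> [x _|x y t _ _ _|x y _ _ /eqP]; rewrite ?ltnn //; first exact: ltn_trans.
  by rewrite -val_eqE neq_ltn => /orP.
have := (ltn_ord a, ltn_ord b, ltn_ord c, ltn_ord u) => -[[[]]] am bm cm um.
rewrite /cyc_of_lt.
have [[-> ?]|[-> ?]] := valD_Zn a u;
have [[-> ?]|[-> ?]] := valD_Zn b u;
have [[-> ?]|[-> ?]] := valD_Zn c u; move=> [] [? ?];
  first [constructor 1; lia | constructor 2; lia | constructor 3; lia].
Qed.

Lemma cyc_ordered_cycZ : cyc_ordered_group cycZ.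
Proof.
apply: cyc_ordered_of_zmod => [|a b c u]; last by rewrite /cyc_of_lt !ltrD2r.
by split=> *; lia.
Qed.

Lemma chart_cycZ : chart (G := cycZ) (fun x : int => 0 < x) 0 id.
Proof.
split=> [//|x|x _|//|x|x y|a b c]; [by left|by exists x|by left|by left|].
by rewrite /= /cyc_of_lt !subr_gt0.
Qed.

(** A single back-and-forth step against the integers answers z by a positive integer m+1 that
    agrees with z up to the rank of [f]; then G and Z/(m+1)Z agree on [f]. *)
Lemma satisfies_zgroup (G : cstruct) (M : zmodType) (pos : M -> Prop)
    (one z : M) (rep : G -> M) (f : sentence) :
  zgroup pos one -> chart pos z rep -> pos z ->
  (forall m, satisfies (cycZn m) f) -> satisfies G f.
Proof.
move=> Mz Gc z0 allf; have Zz := zgroup_int; have [Mo Zo] := (Mz.1, Zz.1).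
have [y sim] := akin_forth z Mz Zz (akin_one (next_bound (rank (val f)).+1) Mo Zo).
have y0 : 0 < y.
  have [_ _ sgn] := sim; apply/(sgn (z, y)) => //.
  by apply: (@combs_leq _ 1) => //; apply: mem_combs; rewrite mem_head.
case: y y0 sim => [[|m]|//] // _ sim.
apply/(satisfies_charts (f := f) Mz Zz Gc (chart_cycZn m)); last exact: allf.
exact: akin_leq sim.
Qed.

(** With z = 0 on both sides the pair (0, 0) contributes nothing to combinations, and the two units
    generate isomorphic copies of Z. *)
Lemma elem_equiv_cycZ (G : cstruct) (M : zmodType) (pos : M -> Prop)
    (one : M) (rep : G -> M) :
  zgroup pos one -> chart pos 0 rep -> elem_equiv G cycZ.
Proof.
move=> Mz Gc f; have Zz := zgroup_int; have [Mo Zo] := (Mz.1, Zz.1).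
apply: (satisfies_charts Mz Zz Gc chart_cycZ).
have [s1 sd sp] := akin_one (rank (val f)) Mo Zo.
split=> [|w|w].
- by rewrite inE s1 orbT.
- rewrite inE => /orP[/eqP->|/sd//].
  by exists 0, 0; rewrite mul0rz mulr0z addr0.
- move=> /combs_consP[c [u [_ us ->]]].
  by rewrite (_ : (0, 0) *~ c + u = u) ?mul0rz ?add0r //; apply: sp.
Qed.

(** * n-regularity and division with remainder *)

Lemma nth_multiples (G : cstruct) (g l : G) n k : (k < n)%N ->
  nth czero (rcons [seq cmul i g | i <- iota 0 n] l) k = cmul k g.
Proof.
move=> kn; rewrite nth_rcons size_map size_iota kn (nth_map 0%N) ?size_iota //.
by rewrite nth_iota.
Qed.

Lemma last_multiples (G : cstruct) (g l : G) n :
  nth czero (rcons [seq cmul i g | i <- iota 0 n] l) n = l.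
Proof. by rewrite nth_rcons size_map size_iota ltnn eqxx. Qed.

Section Division.
Variables (G : cstruct) (M : zmodType) (pos : M -> Prop) (one z : M).
Variables (rep : G -> M) (n : nat).
Hypotheses (Mo : ordered_group pos one) (Gc : chart pos z rep) (z0 : pos z).
Hypothesis n2 : (2 <= n)%N.

Lemma chart_bounds g : nneg pos (rep g) /\ pos (z - rep g).
Proof. by have [/(pos_neq0 Mo z0)|] := chart_range Gc g. Qed.

Lemma chart_cmul g (k : nat) : nneg pos (rep g) -> pos (z - rep g *~ k) ->
  rep (cmul k g) = rep g *~ k.
Proof.
move=> g0; elim: k => [|k IH] lt_z; first exact: (chart0 Gc).
have Ek : rep g *~ k.+1 = rep g + rep g *~ k by rewrite mulrzS; zmod.
have {}IH : rep (cmul k g) = rep g *~ k.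
  by apply: IH; apply: (pos_eq (posDn Mo lt_z g0)); rewrite Ek; zmod.
rewrite [cmul _ _]/(cadd g (cmul k g)) (chart_addE Gc) IH -Ek.
by rewrite asboolT.
Qed.

Lemma chart_cyc0 g h : cyc czero g h -> pos (rep g) /\ pos (rep h - rep g).
Proof.
move=> /(chart_cyc Gc); rewrite /cyc_of_lt (chart0 Gc) !subr0 !sub0r.
by have [[g0 _] [h0 _]] := (chart_bounds g, chart_bounds h); move=> [] [].
Qed.

Lemma chart_cyc_lt g h k : pos (rep h - rep g) -> pos (rep k - rep h) -> cyc g h k.
Proof. by move=> gh hk; apply/(chart_cyc Gc); constructor 1. Qed.

Lemma chain_chart (s : seq G) :
  (forall i j, (i < j < size s)%N ->
     pos (rep (nth czero s j) - rep (nth czero s i))) -> chain s.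
Proof.
move=> inc i j k ij jk ks.
by apply: chart_cyc_lt; apply: inc; rewrite ?ij ?jk //=; apply: ltn_trans ks.
Qed.

(** Let y be x_1 / n rounded up. By discreteness a strictly increasing chain has x_n >= x_1 + (n-1)
    one, so n y lies between x_1 and x_n and the multiples of y do not wrap around. *)
Lemma n_divides_chart (s : n.-tuple G) : chain (czero :: s) ->
  divides_mod one n (rep (head czero s)) -> n_divides s.
Proof.
move=> cs [q [r Er]].
have n0 : (0 < n)%N := ltnW n2.
have n0' : 0 < n%:Z by [].
have sz := size_tuple s.
pose x i := rep (nth czero s i).
have lts i j : (i < j < n)%N -> pos (x i) /\ pos (x j - x i).
  move=> /andP[ij jn]; apply: chart_cyc0.
  by apply: (cs 0%N i.+1 j.+1) => //=; rewrite sz.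
have x0 : rep (head czero s) = x 0%N by rewrite /x nth0.
have xl : rep (last czero s) = x n.-1 by rewrite /x -nth_last sz.
(* Division by excess: the residue of -r gives n y = x_1 + r' one with 0 <= r' < n. *)
pose j := ((- r) %/ n)%Z; pose r' := ((- r) %% n)%Z.
have r'0 : 0 <= r' by rewrite modz_ge0 // gt_eqF.
have r'n : r' < n%:Z by rewrite ltz_pmod.
pose y := q - one *~ j.
have Ey : y *~ n = x 0%N + one *~ r'.
  rewrite -x0 Er (_ : r = - (j * n%:Z + r')) ?/y; last by rewrite -divz_eq opprK.
  by zmod.
have x0p : pos (x 0%N) by have [] := lts 0%N 1%N n2.
have y0 : pos y.
  by rewrite -(posMzE Mo _ n0') Ey; apply: (posDn Mo) => //; apply/(nneg_int Mo).
have gap i : (i < n)%N -> nneg pos (x i - x 0%N - one *~ i).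
  elim: i => [|i IH] lin.
    by rewrite mulr0z subr0 subrr; apply: nneg0 Mo.
  have [_ /(pos_ge_one Mo) xi] := lts i i.+1 ltac:(by rewrite ltnSn).
  apply: (nneg_eq (nnegD Mo xi (IH (ltnW lin)))).
  by rewrite mulrzS; zmod.
have yn : nneg pos (x n.-1 - y *~ n).
  have r1 : nneg pos (one *~ (n.-1%:Z - r')) by apply/(nneg_int Mo); lia.
  apply: (nneg_eq (nnegD Mo (gap n.-1 ltac:(by rewrite ltn_predL)) r1)).
  by rewrite Ey; zmod.
have ynk k : (k <= n)%N -> nneg pos (x n.-1 - y *~ k).
  move=> kn; apply: (nneg_eq (nnegD Mo yn (nnegMzp Mo (_ : 0 <= n%:Z - k%:Z) y0))).
    by lia.
  by zmod.
have zyk k : (k <= n)%N -> pos (z - y *~ k).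
  have [_ xz] := chart_bounds (last czero s).
  by move=> /ynk yk; apply: (pos_eq (posDn Mo xz yk)); rewrite xl; zmod.
have [|g Eg] := chart_surj Gc (x := y).
  by right; split; [apply: pos_nneg Mo _ y0|rewrite -[y]mulr1z; apply: (zyk 1%N)].
have Ek k : (k <= n)%N -> rep (cmul k g) = y *~ k.
  move=> kn; rewrite chart_cmul Eg //; last exact: zyk.
  exact: pos_nneg Mo _ y0.
exists g; split.
  have En := Ek n (leqnn n).
  move: r'0; rewrite le_eqVlt => /orP[/eqP r'E|r'p].
    constructor 2; apply: (chart_inj Gc).
    by rewrite En Ey x0 -r'E mulr0z addr0.
  have [/subr0_eq E|p] := nnegE Mo yn.
    by constructor 3; apply: (chart_inj Gc); rewrite En xl E.
  constructor 1; apply: chart_cyc_lt; rewrite En ?xl // x0 Ey.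
  by rewrite addrC addKr; apply/(pos_int Mo).
apply: chain_chart => i k; rewrite size_rcons size_map size_iota ltnS.
move=> /andP[ik kn].
rewrite (nth_multiples _ _ (leq_trans ik kn)) (Ek i) ?(ltnW (leq_trans ik kn)) //.
have [kn'|nk] := ltnP k n.
  by rewrite nth_multiples // Ek // -mulrzBr; apply: (posMz Mo) => //; lia.
have -> : k = n by apply/eqP; rewrite eqn_leq kn.
rewrite last_multiples xl.
have yni : pos (y *~ (n%:Z - i%:Z)) by apply: (posMz Mo) => //; lia.
by apply: (pos_eq (posDn Mo yni yn)); zmod.
Qed.

(* An n-tuple of consecutive elements leaves n x no other choice than the n
   values x_1, ..., x_1 + n - 1.  The alternative n x = z + (one of these) is
   impossible: it contradicts (n - 1) x < x_n < z. *)
Lemma divides_mod_chart x :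
  pos x -> pos (z - x - one *~ n.-1) ->
  (forall s : n.-tuple G,
    (forall i, (i < n)%N -> rep (nth czero s i) = x + one *~ i) -> n_divides s) ->
  divides_mod one n x.
Proof.
move=> x0 xz div.
have n0 : (0 < n)%N := ltnW n2.
have xi i : (i < n)%N -> exists g, rep g = x + one *~ i.
  move=> lin; apply: (chart_surj Gc); right; split.
    by apply/(pos_nneg Mo)/(posDn Mo x0)/(nneg_int Mo).
  have p1 : nneg pos (one *~ (n.-1%:Z - i%:Z)) by apply/(nneg_int Mo); lia.
  by apply: (pos_eq (posDn Mo xz p1)); zmod.
have [s Es] : exists s : n.-tuple G,
    forall i, (i < n)%N -> rep (nth czero s i) = x + one *~ i.
  have /choice[f Ef] : forall i : 'I_n, exists g, rep g = x + one *~ i.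
    by move=> i; apply: xi.
  exists (mktuple f) => i lin.
  by rewrite -(Ef (Ordinal lin)) -[i]/(nat_of_ord (Ordinal lin)) -tnth_nth tnth_mktuple.
have [g [ng gch]] := div s Es.
have sz := size_tuple s.
have xh : rep (head czero s) = x by rewrite -nth0 Es // mulr0z addr0.
have xl : rep (last czero s) = x + one *~ n.-1 by rewrite -nth_last sz Es // ltn_predL.
pose e := rcons [seq cmul k g | k <- iota 0 n] (last czero s).
have e_n : nth czero e n = last czero s by apply: last_multiples.
have e_k k : (k < n)%N -> nth czero e k = cmul k g by apply: nth_multiples.
have gk i k : (0 < i)%N -> (i < k)%N -> (k <= n)%N -> cyc czero (nth czero e i) (nth czero e k).
  move=> i0 ik kn; rewrite -[czero in cyc czero](e_k 0%N) //.
  by apply: gch => //; rewrite size_rcons size_map size_iota ltnS.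
set y := rep g.
have [y0 yz] := chart_bounds g.
(* The chain condition makes the multiples of g increase, whereas a wrap-around would put (k+1) g
   below k g, because y < z. *)
have Ek k : (k < n)%N -> rep (cmul k g) = y *~ k.
  elim: k => [|k IH] kn; first exact: (chart0 Gc).
  have {}IH := IH (ltnW kn).
  have [->|k0] := posnP k.
    rewrite chart_cmul ?mulr1z //.
  have := gk k k.+1 k0 (ltnSn k) (ltnW kn).
  rewrite !e_k ?(ltnW kn) // => /chart_cyc0[_].
  rewrite [cmul k.+1 g]/(cadd g (cmul k g)) IH.
  have [->|->] := chart_add Gc g (cmul k g); rewrite IH -/y.
    by move=> _; rewrite -[in RHS]addn1 PoszD; zmod.
  move=> p; case: (pos_asym Mo p).
  by apply: (pos_eq yz); zmod.
have nE : n.-1.+1 = n by rewrite prednK.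
have n1 : (n.-1 < n)%N by rewrite ltn_predL.
have [_ yl] := chart_cyc0 (gk n.-1 n ltac:(lia) n1 (leqnn n)).
rewrite e_n e_k // xl Ek // in yl.
set w := rep (cmul n g).
have [wx lw] : nneg pos (w - x) /\ nneg pos (x + one *~ n.-1 - w).
  have n1p : nneg pos (one *~ n.-1) by apply/(nneg_int Mo).
  case: ng => [/(chart_cyc Gc)|E|E]; last first.
  - by rewrite /w E xl; split; [apply: (nneg_eq n1p)|apply: (nneg_eq (nneg0 Mo))]; zmod.
  - by rewrite /w E xh; split; [apply: (nneg_eq (nneg0 Mo))|apply: (nneg_eq n1p)]; zmod.
  have lx : ~ pos (x - (x + one *~ n.-1)).
    by rewrite opprD addrA subrr sub0r; apply: n1p.
  rewrite /cyc_of_lt xh xl -/w => -[] [p1 p2] //.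
  by split; apply: pos_nneg Mo _ _.
have lw' : nneg pos (one *~ n.-1 - (w - x)) by apply: (nneg_eq lw); zmod.
have [k wk _] := between_int Mo wx lw'.
have nEz : n%:Z = n.-1%:Z + 1 by lia.
have [E|E] : w = y *~ n \/ w = y *~ n - z.
- have yn : y *~ n = y + y *~ n.-1 by rewrite nEz; zmod.
  rewrite /w -nE [cmul _.+1 g]/(cadd g (cmul n.-1 g)) nE yn -(Ek _ n1).
  exact: (chart_add Gc).
- by exists y, (- k%:Z); rewrite -E -[w](subrK x) wk; zmod.
case: (pos0 Mo).
(* With w = n y - z, the sum of n (x_n - (n-1) y), (n-1) (z - x - n one), (n-1) (w - x) and (n-2) x
   vanishes identically, although no term is negative and the first is positive. *)
have z1 := nnegMz Mo (_ : 0 <= n.-1%:Z) (pos_ge_one Mo xz).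
have w1 := nnegMz Mo (_ : 0 <= n.-1%:Z) wx.
have x1 : nneg pos (x *~ (n.-1%:Z - 1)) by apply: (nnegMzp Mo) => //; lia.
have l1 : pos ((x + one *~ n.-1 - y *~ n.-1) *~ (n.-1%:Z + 1)) by apply: (posMz Mo) => //; lia.
apply: (pos_eq (posDn Mo l1 (nnegD Mo (nnegD Mo (z1 isT) (w1 isT)) x1))).
by rewrite E nEz; zmod.
Qed.
End Division.

(** * The unwound group *)

(** The parameter [hG] is what lets instance inference find the group laws. *)
Definition group_of (G : cstruct) (hG : cyc_ordered_group G) : Type := G.

Section GroupOf.
Variables (G : cstruct) (hG : cyc_ordered_group G).
HB.instance Definition _ := gen_eqMixin (group_of hG).
HB.instance Definition _ := gen_choiceMixin (group_of hG).
HB.instance Definition _ := GRing.isZmodule.Build (group_of hG)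
  (cog_addA hG) (cog_addC hG) (cog_add0 hG) (cog_addN hG).

Let V : zmodType := group_of hG.
Implicit Types a b c d u : V.

Lemma cycD a b c u : cyc (a + u : G) (b + u : G) (c + u : G) <-> cyc (a : G) b c.
Proof.
split; last exact: (cog_tr hG).
by move=> /(cog_tr hG (- u : V)); rewrite -![cadd _ _]/(_ + - u : V) !addrK.
Qed.

(** The linear order obtained by cutting the cycle at 0, with 0 as least element. *)
Definition below a b : Prop := (a = 0 /\ b <> 0) \/ cyc (0 : V) a b.

Lemma cyc_trans a b c d : cyc (a : G) b c -> cyc (a : G) c d -> cyc (a : G) b d.
Proof.
move=> abc acd; have [ab bc ac] := cog_neq hG abc.
have [_ cd ad] := cog_neq hG acd.
by apply: (slo_trans (cog_lin hG a)) abc acd; apply/nesym.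
Qed.

Lemma cyc_asym a b c : cyc (a : G) b c -> ~ cyc (a : G) c b.
Proof.
by move=> abc /(cyc_trans abc) abb; have [_ /(_ erefl)] := cog_neq hG abb.
Qed.

Lemma below_slo : strict_linear_order setT below.
Proof.
split=> [x _ [[-> //]|p]|x y t _ _ _|x y _ _ xy].
- by have [_ /(_ erefl)] := cog_neq hG p.
- move=> [[-> y0]|xy] [[yE t0]|yt].
  + by rewrite yE in y0.
  + by left; split=> // E; have [_ _] := cog_neq hG yt; rewrite E.
  + by rewrite yE in xy; have [_ _ /(_ erefl)] := cog_neq hG xy.
  + by right; apply: cyc_trans xy yt.
- have [x0|x0] := pselect (x = 0); first by left; left; split=> // y0; apply: xy; rewrite x0 y0.
  have [y0|y0] := pselect (y = 0); first by right; left.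
  by have [p|p] := slo_total (cog_lin hG (0 : V)) x0 y0 xy; [left|right]; right.
Qed.

(** It suffices that increasing triples are cyclic: three distinct elements satisfy [cyc_of_lt] in
    the given order or after a transposition, and asymmetry excludes the latter. *)
Lemma cyc_of_ltP (lt : V -> V -> Prop) : strict_linear_order setT lt ->
  (forall a b c, lt a b -> lt b c -> cyc (a : G) b c) ->
  forall a b c, cyc (a : G) b c <-> cyc_of_lt lt a b c.
Proof.
move=> lto fwd a b c.
have cycR (a' b' c' : V) : cyc (a' : G) b' c' -> cyc (b' : G) c' a' by apply: (cog_rot hG).
split; last first.
  by move=> [] [p1 p2]; [|do 2 apply: (cycR _ _ _)|apply: (cycR _ _ _)]; apply: fwd.
move=> abc; have [ab bc ac] := cog_neq hG abc.
have := cyc_asym abc; have tot x y := slo_total lto (x := x) (y := y) I I.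
by have [l1|l1] := tot _ _ ab; have [l2|l2] := tot _ _ bc; have [l3|l3] := tot _ _ ac;
  first [move=> _; constructor 1; by split | move=> _; constructor 2; by split
        |move=> _; constructor 3; by split
        |move=> []; (apply: fwd) => //; by []
        |move=> []; (apply: (cycR _ _ _); apply: fwd) => //; by []
        |move=> []; (do 2 apply: (cycR _ _ _); apply: fwd) => //; by []].
Qed.

Lemma cyc_below a b c : cyc (a : G) b c <-> cyc_of_lt below a b c.
Proof.
have cycR (a' b' c' : V) : cyc (a' : G) b' c' -> cyc (b' : G) c' a' by apply: (cog_rot hG).
apply: cyc_of_ltP below_slo _ a b c => a b c [[-> b0]|ab] [[bE c0]|bc] //.
- by have [_ _] := cog_neq hG ab; rewrite bE.
- by do 2 apply: (cycR _ _ _); apply: cyc_trans (cycR _ _ _ bc) _; do 2 apply: (cycR _ _ _).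
Qed.

(** Adding b to a passes 0 exactly when the sum falls below a. This is the cocycle of the extension
    of G by Z. *)
Definition carry a b : int := `[< below (a + b) a >].

(** Translation by a turns the condition on b + c and b into one on x = a, y = a + b and t = a + b +
    c. All four carries then depend only on the relative position of x, y, t, and finitely many
    cases remain. *)
Lemma carry_cocycle a b c :
  carry a b + carry (a + b) c = carry b c + carry a (b + c).
Proof.
rewrite /carry !addrA; set x := a; set y := a + b; set t := a + b + c.
have yxE : y = x <-> b = 0.
  by rewrite /y /x; split=> [|->]; rewrite ?addr0 // => E; apply: (addrI a); rewrite addr0.
have txE : t = x <-> b + c = 0.
  by rewrite /t -addrA; split=> [|->]; rewrite ?addr0 // => E; apply: (addrI a); rewrite addr0.
have -> : below (b + c) b = ((t = x /\ y <> x) \/ cyc_of_lt below x t y).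
  apply/propext; rewrite -cyc_below /below -(cycD 0 (b + c) b a) txE yxE.
  by rewrite add0r [b + c + a]addrC [b + a]addrC addrA.
have [irr tr tot] := below_slo.
have {}irr u : ~ below u u by apply: irr.
have {}tr u v w : below u v -> below v w -> below u w by apply: tr.
have {}tot u v : u <> v -> below u v \/ below v u by apply: tot.
have asym u v : below u v -> ~ below v u by move=> uv /(tr _ _ _ uv)/irr.
have cmp u v : [\/ u = v, [/\ below u v, ~ below v u, u <> v & v <> u]
                      | [/\ below v u, ~ below u v, u <> v & v <> u]].
  have [?|uv] := pselect (u = v); [by constructor 1|have vu := nesym uv].
  by have [p|p] := tot _ _ uv; have := asym _ _ p; [constructor 2|constructor 3].
have or3E (P Q R : Prop) : [\/ P, Q | R] = (P \/ Q \/ R).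
  by apply/propext; split=> [[]|[|[]]] p; first
    [tauto | constructor 1; exact: p | constructor 2; exact: p | constructor 3; exact: p].
rewrite /cyc_of_lt or3E; move: x y t {yxE txE} => x y t.
have ix := irr x; have iy := irr y; have it := irr t.
have [E1|[l1 ? ? ?]|[l1 ? ? ?]] := cmp x y; have [E2|[l2 ? ? ?]|[l2 ? ? ?]] := cmp y t;
  have [E3|[l3 ? ? ?]|[l3 ? ? ?]] := cmp x t; subst; try by [exfalso; eauto].
all: repeat (case: asboolP => ?); first [by [] | exfalso; tauto].
Qed.

Lemma carry_bounds a b : 0 <= carry a b <= 1.
Proof. by rewrite /carry; case: `[< _ >]. Qed.

(* The defect of symmetry is bilinear and bounded, hence zero. *)
Lemma carryC a b : carry a b = carry b a.
Proof.
(* Together the three instances say that the defect at (a + a, b) is twice the defect at (a, b);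
   both lie in [-1, 1]. *)
have e1 := carry_cocycle a a b; have e2 := carry_cocycle b a a.
have e3 := carry_cocycle a b a; rewrite (addrC b a) in e2 e3.
have := carry_bounds (a + a) b; have := carry_bounds b (a + a).
have := carry_bounds a b; have := carry_bounds b a.
move: e1 e2 e3.
move: (carry a b) (carry b a) (carry (a + a) b) (carry b (a + a)).
move: (carry a (a + b)) (carry (a + b) a) (carry a a).
lia.
Qed.

Lemma below0 a : below 0 a <-> a <> 0.
Proof.
split=> [[[_ //]|p]|a0]; last by left.
by move=> E; have [_ _] := cog_neq hG p; rewrite E.
Qed.

Lemma carry0r a : carry a 0 = 0.
Proof. by rewrite /carry addr0 asboolF //; apply: (slo_irr below_slo). Qed.

Lemma carry0l a : carry 0 a = 0. Proof. by rewrite carryC carry0r. Qed.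

Lemma carryN a : carry a (- a) = `[< a <> 0 >].
Proof. by rewrite /carry subrr (asbool_equiv_eq (below0 a)). Qed.

End GroupOf.

(* The unwound group of G: an extension of G by Z generated by a full turn. *)
Definition unwound (G : cstruct) (hG : cyc_ordered_group G) : Type :=
  (group_of hG * int)%type.

Section Unwound.
Variables (G : cstruct) (hG : cyc_ordered_group G).
Let V : zmodType := group_of hG.

HB.instance Definition _ := Choice.copy (unwound hG) (group_of hG * int)%type.

Let add (x y : unwound hG) : unwound hG :=
  (x.1 + y.1, x.2 + y.2 + carry x.1 y.1).
Let zero : unwound hG := (0, 0).
Let opp (x : unwound hG) : unwound hG := (- x.1, - x.2 - carry x.1 (- x.1)).

Let addA : associative add.
Proof.
move=> [a i] [b j] [c k]; congr pair; rewrite /= ?addrA //.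
have := carry_cocycle a b c.
by move: (carry a (b + c)) (carry a b) (carry (a + b) c) (carry b c); lia.
Qed.

Let addC : commutative add.
Proof.
move=> [a i] [b j]; congr pair => /=; first exact: addrC.
by rewrite carryC (addrC i).
Qed.

Let add0 : left_id zero add.
Proof. by move=> [a i]; congr pair; rewrite /= ?add0r // carry0l addr0. Qed.

Let addN : left_inverse zero opp add.
Proof.
move=> [a i]; congr pair; rewrite /= ?addNr //.
by rewrite (carryC (- a)); move: (carry a _); lia.
Qed.

HB.instance Definition _ := GRing.isZmodule.Build (unwound hG) addA addC add0 addN.

Let M : zmodType := unwound hG.

Lemma unwoundD (x y : M) : x + y = (x.1 + y.1, x.2 + y.2 + carry x.1 y.1).
Proof. by []. Qed.

Lemma unwoundN (x : M) : - x = (- x.1, - x.2 - carry x.1 (- x.1)).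
Proof. by []. Qed.

Definition proj (x : M) : V := x.1.

Lemma proj_additive : additive proj.
Proof. by []. Qed.

HB.instance Definition _ := GRing.isZmodMorphism.Build M V proj proj_additive.

Definition turn : M := (0, 1).
Definition lift (g : G) : M := (g, 0).
(** Lexicographic: the number of turns comes first, and within one turn every nonzero element of G
    is above 0. *)
Definition upos (x : M) : Prop := 0 < x.2 \/ x.2 = 0 /\ x.1 <> 0.

Lemma lift_diff (g h : V) : lift h - lift g = (h - g, - `[< below h g >]%:Z).
Proof.
apply: (addIr (lift g)); rewrite subrK unwoundD /= subrK addr0.
by rewrite carryC /carry [g + _]addrC subrK addNr.
Qed.

Lemma upos_diff (g h : V) : upos (lift h - lift g) <-> below g h.
Proof.
rewrite lift_diff /upos /=; have bs := below_slo hG; case: asboolP => p.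
  by split=> [[|[]] //|q]; case: (slo_irr bs (x := g) I); apply: (slo_trans bs) p.
split=> [[//|[_ gh]]|q]; last first.
  right; split=> // /subr0_eq E; case: (slo_irr bs (x := g) I).
  by rewrite -{2}E.
have hg : g <> h by move=> E; apply: gh; rewrite E subrr.
by have [] := slo_total bs I I hg.
Qed.

Lemma turn_mulz k : turn *~ k = (0, k).
Proof.
have addi i j : ((0, i) : M) + ((0, j) : M) = (0, i + j).
  by rewrite unwoundD /= addr0 carry0r addr0.
have nat n : turn *~ n%:Z = (0, n%:Z).
  elim: n => // n IH; rewrite mulrzS IH /turn addi //; congr pair; lia.
case: k => n; first exact: nat.
rewrite NegzE mulrNz nat; apply: (addIr ((0, n.+1%:Z) : M)).
by rewrite addNr addi addNr.
Qed.

End Unwound.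

(** The homomorphism [pr] onto G is kept because, in the linear case, divisibility in M has to be
    pushed forward to G. *)
Lemma unwinding (G : cstruct) (hG : cyc_ordered_group G) : discrete G ->
  exists (M : zmodType) (pos : M -> Prop) (one z : M) (rep : G -> M)
         (pr : {additive M -> group_of hG}),
    [/\ ordered_group pos one, chart pos z rep, pos z,
        forall x, exists g k, x = rep g + z *~ k & forall g, pr (rep g) = g].
Proof.
move=> dG; pose V : zmodType := group_of hG; pose M : zmodType := unwound hG.
have bs := below_slo hG.
have uD (x y : M) := unwoundD x y; have uN (x : M) := unwoundN x.
have below_lift (g h : V) := propext (upos_diff (hG := hG) g h).
have turn_lift (g : V) (k : int) : turn hG - ((g, k) : M) = (- g, 1 - k - `[< g <> 0 >]%:Z) :> M.
  by rewrite uN uD /= add0r carry0l carryN addr0 addrA.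
have asym (x : M) : upos x -> ~ upos (- x).
  case: x => g k; rewrite uN /upos /= carryN => -[k0|[-> g0]] [p|[p ng]].
  - by move: p; case: `[< _ >]; lia.
  - by move: p; case: `[< _ >]; lia.
  - by move: p; case: `[< _ >]; lia.
  - by move: p; rewrite asboolT.
have total (x : M) : x <> 0 -> upos x \/ upos (- x).
  case: x => g k; rewrite uN /upos /= carryN => gk.
  have [g0|g0] := pselect (g = 0).
    have k0 : k <> 0 by move=> k0; apply: gk; rewrite g0 k0.
    by rewrite asboolF //; lia.
  have ng : - g <> 0 by move=> E; apply: g0; rewrite -[g]opprK E oppr0.
  rewrite asboolT //; have [?|k0] := ltP 0 k; first by left; left.
  have [->|k0'] := eqVneq k 0; first by left; right.
  have [->|k1] := eqVneq k (-1); first by right; right.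
  by right; left; lia.
have posD (x y : M) : upos x -> upos y -> upos (x + y).
  case: x y => [g k] [h l]; rewrite uD /upos /=; have := carry_bounds (hG := hG) g h.
  have kl c : 0 <= c <= 1 -> 0 < k + l -> 0 < k + l + c by lia.
  move=> c01 [k0|[k0 g0]] [l0|[l0 h0]]; try by left; apply: kl => //; lia.
  have [gh|gh] := pselect (g + h = 0); last first.
    by case/andP: c01; rewrite k0 l0 !add0r le_eqVlt => /orP[/eqP<-|]; [right|left].
  left; rewrite k0 l0 !add0r /carry gh asboolT //.
  exact/below0.
(* For trivial G the unwound group is Z and its least positive element is a full turn; otherwise it
   is the lift of the least nonzero element of G. *)
have [one [one_pos one_least]] : exists one : M, upos one /\
    forall x, upos x -> x = one \/ upos (x - one).
  have [g0|[e [e0 eP]]] := dG.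
    exists (turn hG); split=> [|[g k]]; first by left.
    rewrite (g0 g) => -[/= k0|[_ /(_ erefl)//]].
    rewrite uN uD /upos /= oppr0 !carry0r.
    have [->|k1] := eqVneq k 1; first by left.
    by right; left; lia.
  exists (lift hG e); split=> [|[g k]]; first by right.
  move=> [/= k0|[/= -> g0]]; last first.
    have [->|eg] := eP g g0; first by left.
    by right; rewrite (below_lift e g); right.
  right; rewrite uN uD /upos /= carryN asboolT //.
  have [->|ge] := pselect (g = e).
    by left; rewrite carryN asboolT //; lia.
  have := carry_bounds (hG := hG) g (- (e : V)); move: (carry _ _) => c c01.
  have [kc|kc] := ltP 0 (k + (- 0 - 1) + c); first by left.
  right; split; first lia.
  by move=> /subr0_eq.
have Mo : ordered_group (@upos G hG) one by split.
have lift_bounds (g : V) : nneg (@upos G hG) (lift hG g) /\ upos (turn hG - lift hG g).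
  split.
    rewrite /nneg uN /upos /= carryN => -[|[]]; first by case: `[< _ >].
    by case: asboolP => // /contrapT -> _; rewrite oppr0.
  rewrite turn_lift /upos /=; case: asboolP => [g0|_]; last by left.
  by right; split=> // E; apply: g0; rewrite -[g]opprK E oppr0.
exists M, (@upos G hG), one, (turn hG), (@lift G hG), (@proj G hG); split=> //; first last.
- by move=> [g k]; exists g, k; rewrite turn_mulz uD /= addr0 carry0r addr0 add0r.
- by left.
split=> [g h [//]|g|[g k]|//|g|g h|a b c].
- by right; apply: lift_bounds.
- move=> [/(congr1 snd)//|[]]; rewrite turn_lift /nneg uN /upos /= carryN => n p.
  suff k0 : k = 0 by exists g; rewrite k0.
  move: n p; case: asboolP => [g0|/contrapT->].
    have ng : - (g : V) <> 0 by move=> E; apply: g0; rewrite -[g]opprK E oppr0.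
    move=> n p; have n1 : ~ (0 < - k - 1) by move=> ?; apply: n; left.
    have n2 : - k - 1 <> 0 by move=> ?; apply: n; right.
    by case: p => [|[]]; lia.
  rewrite !oppr0 !addr0 => n [p|[_ /(_ erefl)//]].
  have n1 : ~ (0 < - k) by move=> ?; apply: n; left.
  by lia.
- rewrite uN turn_lift /= carryN; case: asboolP => [g0|/contrapT->]; [right|left].
    by rewrite /lift; congr pair; lia.
  by congr pair; rewrite /= oppr0.
- have -> : lift hG g + lift hG h - turn hG = ((g : V) + (h : V), carry (g : V) (h : V) - 1) :> M.
    by rewrite !uD uN /= !(oppr0, carry0r, addr0) add0r.
  rewrite uD /= !add0r; have c01 := carry_bounds (hG := hG) g h.
  have [->|c0] := eqVneq (carry (g : V) (h : V)) 0; first by left.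
  by right; rewrite (_ : carry (g : V) (h : V) - 1 = 0) //; move: (carry _ _) c0 c01 => c; lia.
- by rewrite (cyc_below (hG := hG)) /cyc_of_lt !below_lift.
Qed.

(** * Discrete regular groups *)

Section Structure.
Variables (G : cstruct) (hG : cyc_ordered_group G) (M : zmodType).
Variables (pos : M -> Prop) (one z : M) (rep : G -> M).
Variable pr : {additive M -> group_of hG}.
Hypotheses (Mo : ordered_group pos one) (Gc : chart pos z rep) (z0 : pos z).
Hypothesis gen : forall x, exists g k, x = rep g + z *~ k.
Hypothesis prK : forall g, pr (rep g) = g.

Let bounds := chart_bounds Mo Gc z0.

Lemma zgroup_gen :
  (forall n, (2 <= n)%N -> divides_mod one n z) ->
  (forall n, (2 <= n)%N -> forall g, divides_mod one n (rep g)) ->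
  zgroup pos one.
Proof.
move=> dz dG; split=> // -[|[|n]] // _ x; first by exists x, 0; zmod.
have [g [k ->]] := gen x.
by apply: divides_modD; [apply: dG|apply: divides_modMz; apply: dz].
Qed.

Lemma zgroup_finite (k : nat) : nneg pos (one *~ k - z) -> zgroup pos one.
Proof.
move=> zk; have [k' zE _] := between_int Mo (pos_nneg Mo z0) zk.
apply: zgroup_gen => n _ => [|g]; first by rewrite zE; apply: divides_mod_int.
have [g0 gz] := bounds g.
have [|j -> _] := between_int Mo (x := rep g) (n := k) g0.
  by apply: (nneg_eq (nnegD Mo zk (pos_nneg Mo gz))); zmod.
exact: divides_mod_int.
Qed.

Lemma infinite_int : (forall k : nat, pos (z - one *~ k)) ->
  forall k : int, pos (z - one *~ k).
Proof.
move=> inf [k|k]; first exact: inf.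
have n0 : nneg pos (one *~ k.+1) by apply/(nneg_int Mo).
by apply: (pos_eq (posDn Mo z0 n0)); rewrite NegzE; zmod.
Qed.

(* In an infinite group the dividend may be shifted by n, so that enough room
   is left above it. *)
Lemma divides_shift n y : nneg pos y ->
  (pos (y - one *~ n%:Z) -> divides_mod one n (y - one *~ n%:Z)) ->
  divides_mod one n y.
Proof.
move=> y0 dy; have [/dy d|ny] := pos_or pos (y - one *~ n%:Z).
  by rewrite -[y](subrK (one *~ n)); apply: divides_modD d (divides_mod_int _ _ _).
have [|k -> _] := between_int Mo (n := n) y0; last exact: divides_mod_int.
by apply: (nneg_eq ny); zmod.
Qed.

Lemma chain_consecutive n (s : n.-tuple G) x : pos x ->
  (forall i, (i < n)%N -> rep (nth czero s i) = x + one *~ i) ->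
  forall i j, (i < j < n.+1)%N ->
    pos (rep (nth czero (czero :: s) j) - rep (nth czero (czero :: s) i)).
Proof.
move=> x0 xs [|i] [|j] /andP[] // ij jn; rewrite /= (xs j) //.
  by rewrite (chart0 Gc) subr0; apply: (posDn Mo x0); apply/(nneg_int Mo).
rewrite (xs i) ?(ltn_trans (_ : i < j)%N jn) // opprD addrACA subrr add0r -mulrzBr.
by apply/(pos_int Mo); lia.
Qed.

Lemma zgroup_c_regular : c_regular G -> zgroup pos one.
Proof.
move=> cr; have [[k zk]|inf] := pselect (exists k : nat, nneg pos (one *~ k - z)).
  exact: zgroup_finite zk.
have {}inf (k : nat) : pos (z - one *~ k).
  have [//|nz] := pos_or pos (z - one *~ k).
  by case: inf; exists k; apply: (nneg_eq nz); zmod.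
have dv n x : (2 <= n)%N -> pos x -> pos (z - x - one *~ n.-1) -> divides_mod one n x.
  move=> n2 x0 xz; apply: (divides_mod_chart Mo Gc z0 n2 x0 xz) => s xs.
  apply: cr n2 _ _; apply: (chain_chart Gc) => i j.
  by rewrite [size _]/= size_tuple; apply: (chain_consecutive x0 xs).
have nE n : (2 <= n)%N -> n%:Z = n.-1%:Z + 1 by lia.
apply: zgroup_gen => n n2 => [|g].
  apply: divides_shift; first exact: pos_nneg Mo _ z0.
  move=> p; apply: dv => //; apply: (pos_eq (pos_one Mo)).
  by rewrite (nE n n2); zmod.
have [g0 gz] := bounds g; apply: divides_shift => // p; apply: dv => //.
by apply: (pos_eq (posD Mo gz (pos_one Mo))); rewrite (nE n n2); zmod.
Qed.

(** After the shift x = y - n one, the last of the n consecutive elements is y - one. Its double is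
    below z, which is the condition x_n < -x_n in the hypothesis of regularity. *)
Lemma divides_half n y : regular G -> (forall k : nat, pos (z - one *~ k)) ->
  (2 <= n)%N -> nneg pos y -> nneg pos (z - y *~ 2) -> divides_mod one n y.
Proof.
move=> rG inf n2 y0 yz; apply: divides_shift => // x0.
set x := y - _ in x0 *.
have nE : n%:Z = n.-1%:Z + 1 by lia.
have xz2 : pos (z - (x + one *~ n.-1) *~ 2).
  apply: (pos_eq (posDn Mo (posMz Mo (_ : 0 < 2) (pos_one Mo)) yz)) => //.
  by rewrite /x nE; zmod.
have xn0 : nneg pos (x + one *~ n.-1).
  by apply/(pos_nneg Mo)/(posDn Mo x0)/(nneg_int Mo).
have xz : pos (z - x - one *~ n.-1).
  by apply: (pos_eq (posDn Mo xz2 xn0)); zmod.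
apply: (divides_mod_chart Mo Gc z0 n2 x0 xz) => s xs.
have n0 : (0 < n)%N := ltnW n2.
have xl : rep (last czero s) = x + one *~ n.-1.
  by rewrite -nth_last size_tuple xs // ltn_predL.
have lp : pos (rep (last czero s)).
  by rewrite xl; apply/(posDn Mo x0)/(nneg_int Mo).
apply: rG n2 _ _; apply: (chain_chart Gc) => i j.
have nl : nth czero (czero :: s) n = last czero s.
  by have := nth_last czero (czero :: s); rewrite [_.-1]/= size_tuple.
have le_last i' : (i' <= n)%N ->
    nneg pos (rep (last czero s) - rep (nth czero (czero :: s) i')).
  rewrite leq_eqVlt -nl => /orP[/eqP->|i'n]; first by rewrite subrr; apply: nneg0 Mo.
  by apply/(pos_nneg Mo)/(chain_consecutive x0 xs); rewrite i'n ltnSn.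
rewrite -rcons_cons size_rcons [size (_ :: _)]/= size_tuple => /andP[ij].
rewrite ltnS leq_eqVlt => /orP[/eqP jn|jn]; last first.
  rewrite !nth_rcons [size (_ :: _)]/= size_tuple jn (ltn_trans ij jn).
  by apply: (chain_consecutive x0 xs); rewrite ij.
rewrite jn !nth_rcons [size (_ :: _)]/= size_tuple ltnn eqxx -jn ij.
rewrite (chart_oppE Mo Gc) asboolT //.
have p2 : pos (z - rep (last czero s) *~ 2) by rewrite xl.
by apply: (pos_eq (posDn Mo p2 (le_last i ltac:(by rewrite -ltnS -jn)))); zmod.
Qed.

(** Some multiple m' y leaves a remainder w = z - m' y between 0 and y. Both y and w lie in the
    first half-turn, so z is divisible up to an integer; an element of the second half-turn is then
    z minus one of the first. *)
Lemma zgroup_nonlinear y (m : nat) : regular G ->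
  (forall k : nat, pos (z - one *~ k)) ->
  pos y -> nneg pos (z - y *~ 2) -> nneg pos (y *~ m - z) -> zgroup pos one.
Proof.
move=> rG inf y0 yz ym.
have [m' [w0 yw]] : exists m' : nat,
    nneg pos (z - y *~ m') /\ nneg pos (y - (z - y *~ m')).
  elim: m ym => [|m IH] ym.
    by case: ym; rewrite mulr0z sub0r opprK.
  have [p|np] := pos_or pos (z - y *~ m); last by apply: IH; apply: (nneg_eq np); zmod.
  exists m; split; first exact: pos_nneg Mo _ p.
  by apply: (nneg_eq ym); rewrite mulrzS; zmod.
have half n x : (2 <= n)%N -> nneg pos x -> nneg pos (z - x *~ 2) -> divides_mod one n x.
  exact: divides_half.
have dz n : (2 <= n)%N -> divides_mod one n z.
  move=> n2; rewrite -[z](subrK (y *~ m')); apply: divides_modD.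
    apply: half => //; apply: (nneg_eq (nnegD Mo (nnegMz Mo (_ : 0 <= 2) yw) yz)) => //.
    by zmod.
  by apply/divides_modMz/half => //; apply: pos_nneg Mo _ y0.
apply: zgroup_gen => // n n2 g; have [g0 gz] := bounds g.
have [p|np] := pos_or pos (z - rep g *~ 2).
  by apply: half => //; apply: pos_nneg Mo _ p.
rewrite -[rep g](subKr z); apply/(divides_modD (dz n n2))/divides_modN/half => //.
  exact: pos_nneg Mo _ gz.
by apply: (nneg_eq np); zmod.
Qed.

(** * The case in which G is linearly ordered *)

Section Linear.
Hypothesis rG : regular G.
Hypothesis inf : forall k : nat, pos (z - one *~ k).
Hypothesis small : forall y, pos y -> nneg pos (z - y *~ 2) ->
  forall m : nat, pos (z - y *~ m).

Let V : zmodType := group_of hG.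

(** The first half-turn consists of the positive elements, the second of the negative ones. *)
Definition lpos (g : V) : Prop := g <> 0 /\ pos (z - rep g *~ 2).

Lemma rep_pos (g : V) : g <> 0 -> pos (rep g).
Proof.
move=> g0; have [n0 _] := bounds g; have [E|//] := nnegE Mo n0.
by case: g0; apply: (chart_inj Gc); rewrite E -(chart0 Gc).
Qed.

Lemma lpos_small g (m : nat) : lpos g -> pos (z - rep g *~ m).
Proof. by move=> [/rep_pos g0 gz]; apply: small => //; apply: pos_nneg Mo _ gz. Qed.

Lemma rep_add (g h : V) : lpos g -> lpos h -> rep (g + h) = rep g + rep h.
Proof.
move=> [_ g2] [_ h2]; rewrite -[g + h]/(cadd g h) (chart_addE Gc) asboolT //.
by rewrite -(posMzE Mo _ (_ : 0 < 2)) //; apply: (pos_eq (posD Mo g2 h2)); zmod.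
Qed.

(** Closure under addition rests on [small]: since 4 g and 4 h stay below z, so does the double of g
    + h, half the sum of z - 4 g and z - 4 h being z - 2 (g + h). *)
Lemma lposD g h : lpos g -> lpos h -> lpos (g + h).
Proof.
move=> lg lh; have Egh := rep_add lg lh.
have [g0 h0] := (rep_pos lg.1, rep_pos lh.1).
split=> [E|].
  by apply: (pos0 Mo); apply: (pos_eq (posD Mo g0 h0)); rewrite -Egh E -(chart0 Gc).
rewrite Egh -(posMzE Mo _ (_ : 0 < 2)) //.
by apply: (pos_eq (posD Mo (lpos_small 4 lg) (lpos_small 4 lh))); zmod.
Qed.

Lemma repN (g : V) : g <> 0 -> rep (- g) = z - rep g.
Proof. by move=> /rep_pos g0; rewrite -[- g]/(copp g) (chart_oppE Mo Gc) asboolT. Qed.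

Lemma ordered_lpos : ordered_group lpos (pr one).
Proof.
have [|e Ee] := chart_surj Gc (x := one).
  right; split; first exact: pos_nneg Mo _ (pos_one Mo).
  by have := inf 1; rewrite mulr1z.
have e0 : (e : V) <> 0.
  by move=> E; apply: (pos_neq0 Mo (pos_one Mo)); rewrite -Ee E -(chart0 Gc).
have -> : pr one = e by rewrite -Ee prK.
split.
- move=> g [g0 gz] [_]; rewrite repN // => p.
  by apply: (pos_asym Mo gz); apply: (pos_eq p); zmod.
- move=> g g0; have ng0 : - g <> 0 by move=> E; apply: g0; rewrite -[g]opprK E oppr0.
  have rg := rep_pos g0.
  (* An element of order 2 would satisfy 2 g = z, against [small] with m = 2. *)
  have [E|] := pselect (z - rep g *~ 2 = 0).
    case: (pos0 Mo); rewrite -E; apply: (small rg _ 2).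
    by rewrite E; apply: nneg0 Mo.
  move=> /(pos_total Mo)[p|p]; [left|right]; split=> //.
  by rewrite repN //; apply: (pos_eq p); zmod.
- exact: lposD.
- by split=> //; rewrite Ee; apply: (inf 2).
- move=> g [g0 gz]; have [Eg|p] := pos_least Mo (rep_pos g0).
    by left; apply: (chart_inj Gc); rewrite Eg Ee.
  have Ege : rep (g - (e : V)) = rep g - one.
    rewrite -[g - _]/(cadd g (- (e : V) : V)) (chart_addE Gc) repN // Ee asboolF.
      by zmod.
    by move=> q; apply: (pos_asym Mo p); apply: (pos_eq q); zmod.
  right; split; rewrite ?Ege.
    by move=> E; apply: (pos_neq0 Mo p); rewrite -Ege E -(chart0 Gc).
  apply: (pos_eq (posD Mo gz (posMz Mo (_ : 0 < 2) (pos_one Mo)))) => //.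
  by zmod.
Qed.

(** Division of a positive element takes place in M, in the first half-turn; [pr] carries the
    resulting equation to G. *)
Lemma zgroup_lpos : zgroup lpos (pr one).
Proof.
split=> [|[|[|n]] // _ g]; [exact: ordered_lpos|by exists g, 0; zmod|].
have dpos h : lpos h -> divides_mod (pr one) n.+2 h.
  move=> [h0 hz].
  have [q [r E]] : divides_mod one n.+2 (rep h).
    by apply: divides_half => //; apply: pos_nneg Mo _ _ => //; apply: rep_pos.
  exists (pr q), r; rewrite -[h]prK E raddfD.
  by rewrite !raddfMz.
have [->|g0] := pselect (g = 0); first by exists 0, 0; zmod.
have [/dpos//|/dpos/divides_modN] := pos_total ordered_lpos g0.
by rewrite opprK.
Qed.

Let llt (g h : V) : Prop := lpos (h - g).

Lemma llt_slo : strict_linear_order setT llt.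
Proof.
have Lo := ordered_lpos; split=> [x _|x y t _ _ _ xy yt|x y _ _ xy].
- by rewrite /llt subrr => /(pos0 Lo).
- by apply: (pos_eq (posD Lo xy yt)); zmod.
- have [|p|p] := pos_total Lo (x := y - x); first by move=> /subr0_eq/esym.
    by left.
  by right; apply: (pos_eq p); zmod.
Qed.

Lemma llt_cyc a b c : cyc (a : G) b c <-> cyc_of_lt llt a b c.
Proof.
apply: (cyc_of_ltP (hG := hG) llt_slo) => {}a {}b {}c ab bc.
apply/(cycD (hG := hG) _ _ _ (- a)); apply: (chart_cyc_lt Gc); rewrite ?subrr.
  by rewrite (chart0 Gc) subr0; apply: rep_pos ab.1.
rewrite (_ : c - a = (b - a) + (c - b)); last by zmod.
by rewrite rep_add // addrC addKr; apply: rep_pos bc.1.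
Qed.

Lemma linear_regular : linearly_cyc_ordered G /\ elem_equiv G cycZ.
Proof.
have llt_tr x y u : llt x y -> llt (x + u) (y + u).
  by rewrite /llt => p; apply: (pos_eq p); zmod.
split; first by split=> //; exists llt; split; [exact: llt_slo|exact: llt_tr|exact: llt_cyc].
apply: (elem_equiv_cycZ (M := V) (pos := lpos) (rep := id) zgroup_lpos).
by split=> [//|x|x _|//|x|x y|a b c]; [left|exists x|left|left|exact: llt_cyc].
Qed.

End Linear.

End Structure.

(** * The dichotomy for discrete regular groups *)

Definition has_zgroup_chart (G : cstruct) : Prop :=
  exists (M : zmodType) (pos : M -> Prop) (one z : M) (rep : G -> M),
    [/\ zgroup pos one, chart pos z rep & pos z].

Lemma discrete_c_regular_chart (G : cstruct) :
  discrete_c_regular G -> has_zgroup_chart G.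
Proof.
move=> [hG dG cr]; have [M [pos [one [z [rep [pr [Mo Gc z0 gen prK]]]]]]] := unwinding hG dG.
by exists M, pos, one, z, rep; split=> //; apply: (zgroup_c_regular Mo Gc z0 gen cr).
Qed.

(** The distinction is whether M is a Z-group. If it is not, the criteria [zgroup_finite] and
    [zgroup_nonlinear] both fail, and their failure is what the linear case assumes. *)
Lemma discrete_regular_chart (G : cstruct) : discrete_regular G ->
  (linearly_cyc_ordered G /\ elem_equiv G cycZ) \/ has_zgroup_chart G.
Proof.
move=> [hG dG rG]; have [M [pos [one [z [rep [pr [Mo Gc z0 gen prK]]]]]]] := unwinding hG dG.
have [Mz|nMz] := pselect (zgroup pos one); first by right; exists M, pos, one, z, rep.
have inf (k : nat) : pos (z - one *~ k).
  have [//|nz] := pos_or pos (z - one *~ k).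
  case: nMz; apply: (zgroup_finite Mo Gc z0 gen (k := k)).
  by apply: (nneg_eq nz); zmod.
left; apply: (linear_regular Mo Gc z0 prK rG inf) => y y0 yz m.
have [//|nz] := pos_or pos (z - y *~ m).
case: nMz; apply: (zgroup_nonlinear Mo Gc z0 gen rG inf y0 yz (m := m)).
by apply: (nneg_eq nz); zmod.
Qed.

(** * Cyclic groups are discrete and regular *)

Lemma chain_rcons (G : cstruct) (s : seq G) x : chain (rcons s x) -> chain s.
Proof.
move=> c i j k ij jk ks; have := c i j k ij jk.
rewrite size_rcons !nth_rcons ks (ltn_trans jk ks) (ltn_trans ij (ltn_trans jk ks)).
by apply; apply: ltnW.
Qed.

(** If z exceeds all multiples of [one], every representative is a one + b z. The element x_1 lies
    in the first half-turn, which forces b = 0, so x_1 is an integer multiple of [one]. *)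
Lemma cyclic_discrete_regular (G : cstruct) : cyclic G -> discrete_regular G.
Proof.
move=> [hG [g [genG leastG]]].
have dG : discrete G.
  have [g0|g0] := pselect (g = czero); last by right; exists g.
  left=> x; apply: contrapT => x0; have [xg|] := leastG x x0; first by apply: x0; rewrite xg.
  by rewrite g0 => p; have [/(_ erefl)] := cog_neq hG p.
split=> // n n2 s cs.
have [M [pos [one [z [rep [pr [Mo Gc z0 gen prK]]]]]]] := unwinding hG dG.
have bounds := chart_bounds Mo Gc z0.
rewrite -rcons_cons in cs; have cs' := chain_rcons cs.
apply: (n_divides_chart Mo Gc z0 n2 cs').
have [[k zk]|inf] := pselect (exists k : nat, nneg pos (one *~ k - z)).
  by have [_] := zgroup_finite Mo Gc z0 gen zk; apply; apply: ltnW.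
have {}inf (k : nat) : pos (z - one *~ k).
  have [//|nz] := pos_or pos (z - one *~ k).
  by case: inf; exists k; apply: (nneg_eq nz); zmod.
have {}inf := infinite_int Mo z0 inf.
have sz := size_tuple s.
have hd : nth czero (rcons (czero :: s) (copp (last czero s))) 1 = head czero s.
  by case: (tval s) sz => [|x s'] // E; move: n2; rewrite -E.
have lt : nth czero (rcons (czero :: s) (copp (last czero s))) n = last czero s.
  rewrite nth_rcons [size (_ :: _)]/= sz ltnS leqnn.
  by have := nth_last czero (czero :: s); rewrite [_.-1]/= sz.
have nl : nth czero (rcons (czero :: s) (copp (last czero s))) n.+1 = copp (last czero s).
  by rewrite nth_rcons [size (_ :: _)]/= sz ltnn eqxx.
(* Two triples of the chain suffice: (0, x_1, x_n) and (0, x_n, -x_n) give 2 x_1 < 2 x_n < z. *)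
have := cs 0%N 1%N n isT n2; have := cs 0%N n n.+1 (ltnW n2) (ltnSn n).
rewrite size_rcons [size (_ :: _)]/= sz !ltnS leqnn leqnSn hd lt nl.
move=> /(_ isT) /(chart_cyc0 Mo Gc z0) [l0 lz] /(_ isT) /(chart_cyc0 Mo Gc z0) [h0 hl].
have h2 : pos (z - rep (head czero s) *~ 2).
  rewrite (chart_oppE Mo Gc) asboolT // in lz.
  by apply: (pos_eq (posD Mo (posD Mo lz hl) hl)); zmod.
have hd0 : head czero s <> czero.
  by move=> E; apply: (pos_neq0 Mo h0); rewrite E (chart0 Gc).
have g0 : g <> czero.
  move=> E; have [hg|p] := leastG _ hd0; first by apply: hd0; rewrite hg.
  by rewrite E in p; have [/(_ erefl)] := cog_neq hG p.
have gE : rep g = one.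
  have gp : pos (rep g).
    have [n0 _] := bounds g; have [E|//] := nnegE Mo n0.
    by case: g0; apply: (chart_inj Gc); rewrite E (chart0 Gc).
  have [//|g1] := pos_least Mo gp.
  have [|e Ee] := chart_surj Gc (x := one).
    by right; split; [exact: pos_nneg Mo _ (pos_one Mo)|have := inf 1; rewrite mulr1z].
  have e0 : e <> czero.
    by move=> E; apply: (pos_neq0 Mo (pos_one Mo)); rewrite -Ee E (chart0 Gc).
  have [<-//|/(chart_cyc0 Mo Gc z0)[_]] := leastG e e0.
  by rewrite Ee => /(pos_asym Mo); rewrite opprB.
have repE x : exists a b : int, rep x = one *~ a + z *~ b.
  have cm k : exists a b : int, rep (cmul k g) = one *~ a + z *~ b.
    elim: k => [|k [a [b E]]]; first by exists 0, 0; rewrite (chart0 Gc); zmod.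
    have [|] := chart_add Gc g (cmul k g); rewrite -[cadd _ _]/(cmul k.+1 g) gE E => ->.
      by exists (a + 1), b; zmod.
    by exists (a + 1), (b - 1); zmod.
  have [k [->|->]] := genG x; first exact: cm.
  have [a [b E]] := cm k; have [|] := chart_opp Gc (cmul k g); rewrite E => ->.
    by exists (- a), (- b); zmod.
  by exists (- a), (1 - b); zmod.
have [a [b E]] := repE (head czero s); rewrite E in h0 h2 *.
case: (ltrgtP b 0) => [b0|b0|->]; last by exists 0, a; zmod.
  have zb : nneg pos (z *~ (- b - 1)) by apply: (nnegMzp Mo) => //; lia.
  case: (pos0 Mo); apply: (pos_eq (posDn Mo (posD Mo h0 (inf a)) zb)); zmod.
have zb : nneg pos (z *~ (2 * b - 2)) by apply: (nnegMzp Mo) => //; lia.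
case: (pos0 Mo); apply: (pos_eq (posDn Mo (posD Mo h2 (inf (- 2 * a))) zb)); zmod.
Qed.

Lemma cyclic_cycZ : cyclic cycZ.
Proof.
split; first exact: cyc_ordered_cycZ.
have cm k : cmul k (1 : cycZ) = Posz k by elim: k => //= k; rewrite /cmul /= => ->; rewrite intS.
exists (1 : int); split=> [[k|k]|x x0].
- by exists k; left; rewrite cm.
- by exists k.+1; right; rewrite cm NegzE.
- rewrite /= /cyc_of_lt /=; case: (ltrgtP x 0) => [xn|xp|/x0//].
    by right; constructor 3.
  case: (ltrgtP x 1) => [x1|x1|->]; [by exfalso; lia| |by left].
  by right; constructor 1.
Qed.

Lemma cyclic_cycZn m : cyclic (cycZn m).
Proof.
split; first exact: cyc_ordered_cycZn.
pose g : cycZn m := inZp 1.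
have cm k : cmul k g = inZp k :> 'I_m.+1.
  elim: k => [|k IH]; first by apply: val_inj; rewrite /= mod0n.
  rewrite -[cmul k.+1 g]/(cadd g (cmul k g)) IH; apply: val_inj.
  by rewrite /= modnDm add1n.
exists g; split=> [x|x x0].
  by exists (nat_of_ord x); left; rewrite cm; apply: val_inj; rewrite /= modn_small.
have xp : (0 < nat_of_ord x)%N.
  by rewrite lt0n; apply/eqP => E; apply: x0; apply: val_inj; rewrite /= E.
have xm : (nat_of_ord x < m.+1)%N by [].
have gE : nat_of_ord g = 1%N by rewrite /= modn_small //; apply: leq_ltn_trans xp xm.
have [x1|x1] := eqVneq (nat_of_ord x) 1%N.
  by left; apply: val_inj; apply: etrans x1 (esym gE).
right; constructor 1; rewrite gE; split=> //.
by rewrite ltn_neqAle eq_sym x1.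
Qed.

Lemma discrete_c_regular_cycZn m : discrete_c_regular (cycZn m).
Proof.
have Zz := zgroup_int; have Zo := Zz.1; have Gc := chart_cycZn m.
have z0 : 0 < m.+1%:Z by [].
split; [exact: cyc_ordered_cycZn| |].
  by have [] := cyclic_discrete_regular (cyclic_cycZn m).
move=> n n2 s cs; apply: (n_divides_chart Zo Gc z0 n2 cs).
by apply: Zz.2; apply: ltnW.
Qed.

(** * Definability *)

(** Only the existence of a formula with the right truth value is recorded, so axioms are assembled
    from closure properties without being written out. *)
Definition definable (k : nat) (P : forall M : cstruct, (nat -> M) -> Prop) : Prop :=
  exists2 f, closed_formula k f & forall (M : cstruct) (e : nat -> M), holds e f <-> P M e.

Section Definability.
Implicit Types P Q : forall M : cstruct, (nat -> M) -> Prop.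

Lemma definable_ext k P Q : definable k P ->
  (forall M e, P M e <-> Q M e) -> definable k Q.
Proof. by move=> [f kf fP] PQ; exists f => // M e; rewrite fP. Qed.

Lemma definable_formula k f : closed_formula k f ->
  definable k (fun M e => holds e f).
Proof. by exists f. Qed.

Lemma definable_imp k P Q : definable k P -> definable k Q ->
  definable k (fun M e => P M e -> Q M e).
Proof.
move=> [f kf fP] [g kg gQ]; exists (Imp f g); first by rewrite /= kf.
by move=> M e /=; rewrite fP gQ.
Qed.

Lemma definable_not k P : definable k P -> definable k (fun M e => ~ P M e).
Proof. by move=> dP; apply: definable_imp (definable_formula (f := Bot) _). Qed.

Lemma definable_all k P : definable k.+1 P ->
  definable k (fun M e => forall x, P M (env_cons x e)).
Proof.
move=> [f kf fP]; exists (All f) => //= M e.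
by split=> h x; apply/fP.
Qed.

Lemma definable_ex k P : definable k.+1 P ->
  definable k (fun M e => exists x, P M (env_cons x e)).
Proof.
move=> /definable_not/definable_all/definable_not dP; apply: definable_ext dP _ => M e.
split=> [|[x px] /(_ x)//]; apply: contra_notP => h x px.
by apply: h; exists x.
Qed.

Lemma definable_or k P Q : definable k P -> definable k Q ->
  definable k (fun M e => P M e \/ Q M e).
Proof.
move=> /definable_not dP dQ; apply: definable_ext (definable_imp dP dQ) _ => M e.
by split=> [h|[]//]; have [|/h] := pselect (P M e); [left|right].
Qed.

Lemma definable_and k P Q : definable k P -> definable k Q ->
  definable k (fun M e => P M e /\ Q M e).
Proof.
move=> dP /definable_not dQ.
apply: definable_ext (definable_not (definable_imp dP dQ)) _ => M e.
split=> [h|[p q] /(_ p)//]; split; apply: contrapT => n; by apply: h => // p.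
Qed.

Lemma definable_true k : definable k (fun _ _ => True).
Proof. by exists (Imp Bot Bot) => // M e; split=> // _ []. Qed.

(** [A] does not depend on the structure, so the formula may be chosen according to the truth of
    [A]. *)
Lemma definable_guard k (A : Prop) P : (A -> definable k P) ->
  definable k (fun M e => A -> P M e).
Proof.
move=> dP; have [a|na] := pselect A.
  by apply: definable_ext (dP a) _ => M e; split=> // /(_ a).
by apply: definable_ext (definable_true k) _ => M e; split=> // _ /na.
Qed.

Lemma definable_forall_lt k n (P : nat -> forall M : cstruct, (nat -> M) -> Prop) :
  (forall i, definable k (P i)) ->
  definable k (fun M e => forall i, (i < n)%N -> P i M e).
Proof.
move=> dP; elim: n => [|n IH].
  by apply: definable_ext (definable_true k) _ => M e; split.
apply: definable_ext (definable_and IH (dP n)) _ => M e; split=> [[h hn] i|h].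
  by rewrite ltnS leq_eqVlt => /orP[/eqP->|/h].
by split=> [i /ltnW lin|]; apply: h.
Qed.

Lemma closed_nth k ts i : all (closed_term k) ts -> closed_term k (nth Zero ts i).
Proof.
by move=> /all_nthP h; have [/h|/(nth_default Zero)->] := ltnP i (size ts).
Qed.

Lemma eval_nth (M : cstruct) (e : nat -> M) ts i :
  nth czero (map (eval e) ts) i = eval e (nth Zero ts i).
Proof.
have [lt|ge] := ltnP i (size ts); first by rewrite (nth_map Zero).
by rewrite !nth_default ?size_map.
Qed.

Lemma definable_chain k ts : all (closed_term k) ts ->
  definable k (fun M e => chain (map (eval e) ts)).
Proof.
move=> ct; pose N := size ts.
have dP i j l : definable k (fun M (e : nat -> M) => (i < j)%N -> (j < l)%N ->
    cyc (nth czero (map (eval e) ts) i) (nth czero (map (eval e) ts) j)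
        (nth czero (map (eval e) ts) l)).
  do 2 apply: definable_guard => _.
  exists (Cyc (nth Zero ts i) (nth Zero ts j) (nth Zero ts l)).
    by rewrite /= !closed_nth.
  by move=> M e; rewrite !eval_nth.
apply: definable_ext
  (definable_forall_lt N (fun i => definable_forall_lt N (fun j =>
    definable_forall_lt N (fun l => dP i j l)))) _ => M e.
rewrite /chain size_map; split=> [h i j l ij jl ln|h i _ j _ l ln ij jl]; last exact: h.
by apply: h => //; [apply: ltn_trans (ltn_trans jl ln)|apply: ltn_trans ln].
Qed.

(** The outermost quantifier binds the highest index, so the list is taken apart from the right. *)
Lemma holds_iter_All n f (M : cstruct) (e : nat -> M) :
  holds e (iter n All f) <->
  forall s : seq M, size s = n -> holds (foldr (@env_cons M) e s) f.
Proof.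
elim: n e => [|n IH] e /=.
  by split=> [h s /size0nil->//|/(_ [::] erefl)].
split=> [h|h x].
  case/lastP=> // s x; rewrite size_rcons => -[sn]; rewrite foldr_rcons.
  by have /IH := h x; apply.
by apply/IH => s sn; have := h (rcons s x); rewrite size_rcons foldr_rcons sn; apply.
Qed.

Lemma closed_iter_All n k f :
  closed_formula k (iter n All f) = closed_formula (n + k) f.
Proof. by elim: n k => //= n IH k; rewrite IH addnS. Qed.

Lemma mkseq_foldr (M : cstruct) (s : seq M) (e : nat -> M) :
  mkseq (foldr (@env_cons M) e s) (size s) = s.
Proof.
apply: (@eq_from_nth _ czero); rewrite size_mkseq // => i lin.
by rewrite nth_mkseq //; elim: s i lin => // x s IH [|i] //=; apply: IH.
Qed.

Lemma definable_tuple n (Q : forall M : cstruct, seq M -> Prop) :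
  definable n (fun M e => Q M (mkseq e n)) ->
  definable 0 (fun M _ => forall s : n.-tuple M, Q M s).
Proof.
move=> [f nf fQ]; exists (iter n All f); first by rewrite closed_iter_All addn0.
move=> M e; rewrite holds_iter_All; split=> [h s|h s sn].
  have E := mkseq_foldr s e; rewrite size_tuple in E.
  by have /fQ := h s (size_tuple s); rewrite E.
by apply/fQ; rewrite -sn mkseq_foldr; apply: (h (Tuple (introT eqP sn))).
Qed.

Definition multiple (k : nat) (t : term) : term := iter k (Add t) Zero.

Lemma eval_multiple (M : cstruct) (e : nat -> M) k t :
  eval e (multiple k t) = cmul k (eval e t).
Proof. by elim: k => //= k ->. Qed.

Lemma closed_multiple m k t : closed_term m t -> closed_term m (multiple k t).
Proof. by move=> ct; elim: k => //= k ->; rewrite ct. Qed.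

Lemma head_map_eval (M : cstruct) (e : nat -> M) ts :
  head czero (map (eval e) ts) = eval e (head Zero ts).
Proof. by case: ts. Qed.

Lemma last_map_eval (M : cstruct) (e : nat -> M) ts :
  last czero (map (eval e) ts) = eval e (last Zero ts).
Proof. exact: (last_map (eval e) ts Zero). Qed.

Lemma closed_head k ts : all (closed_term k) ts -> closed_term k (head Zero ts).
Proof. by case: ts => //= t ts /andP[]. Qed.

Lemma closed_last k ts : all (closed_term k) ts -> closed_term k (last Zero ts).
Proof. by move=> ct; rewrite -nth_last; apply: closed_nth. Qed.

(** The body of [n_divides] for plain sequences, because the first n values of an environment come
    as [mkseq e n]. *)
Definition divides_seq n (M : cstruct) (s : seq M) : Prop :=
  exists x : M,
    [\/ cyc (head czero s) (cmul n x) (last czero s),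
        cmul n x = head czero s | cmul n x = last czero s] /\
    chain (rcons [seq cmul k x | k <- iota 0 n] (last czero s)).

Lemma all_closed_Var (h : nat -> nat) n m : (forall i, (i < n)%N -> (h i < m)%N) ->
  all (closed_term m) (mkseq (fun i => Var (h i)) n).
Proof. by move=> hm; rewrite all_map; apply/allP => i; rewrite mem_iota => /hm. Qed.

Lemma definable_divides n :
  definable n (fun M e => divides_seq n (mkseq e n)).
Proof.
pose ts := mkseq (fun i => Var i.+1) n.
have cts : all (closed_term n.+1) ts by apply: all_closed_Var.
have tsE (M : cstruct) (e : nat -> M) x : mkseq e n = map (eval (env_cons x e)) ts.
  by rewrite /ts /mkseq -map_comp.
pose x := Var 0; pose us := rcons [seq multiple k x | k <- iota 0 n] (last Zero ts).
have cus : all (closed_term n.+1) us.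
  rewrite all_rcons closed_last // all_map; apply/allP => k _.
  exact: closed_multiple.
have d1 := definable_formula (k := n.+1)
  (f := Cyc (head Zero ts) (multiple n x) (last Zero ts)) _.
have d2 := definable_formula (k := n.+1) (f := Eq (multiple n x) (head Zero ts)) _.
have d3 := definable_formula (k := n.+1) (f := Eq (multiple n x) (last Zero ts)) _.
have h1 : closed_term n.+1 (multiple n x) by apply: closed_multiple.
have h2 := closed_head cts; have h3 := closed_last cts.
apply: definable_ext (definable_ex (definable_and (definable_or (d1 _)
  (definable_or (d2 _) (d3 _))) (definable_chain cus))) _; rewrite /= ?h1 ?h2 ?h3 //.
move=> M e; rewrite /divides_seq.
have E y : (holds (env_cons y e) (Cyc (head Zero ts) (multiple n x) (last Zero ts)) \/
   (holds (env_cons y e) (Eq (multiple n x) (head Zero ts)) \/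
    holds (env_cons y e) (Eq (multiple n x) (last Zero ts)))) /\
   chain (map (eval (env_cons y e)) us) <->
   [\/ cyc (head czero (mkseq e n)) (cmul n y) (last czero (mkseq e n)),
        cmul n y = head czero (mkseq e n) | cmul n y = last czero (mkseq e n)] /\
    chain (rcons [seq cmul k y | k <- iota 0 n] (last czero (mkseq e n))).
  rewrite (tsE M e y) head_map_eval last_map_eval.
  rewrite /us map_rcons -map_comp /= eval_multiple.
  rewrite (eq_map (g := fun k => cmul k y)); last by move=> k /=; rewrite eval_multiple.
  split=> -[h c]; split=> //.
    by case: h => [|[]]; [constructor 1|constructor 2|constructor 3].
  by case: h; [left|right; left|right; right].
by split=> -[y /E]; exists y.
Qed.

Lemma definable_n_regular n : definable 0 (fun M _ => n_regular n M).
Proof.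
apply: (definable_tuple (Q := fun M s =>
  chain (czero :: rcons s (copp (last czero s))) -> divides_seq n s)).
apply: definable_imp (definable_divides n).
pose ts := mkseq Var n; have cts : all (closed_term n) ts by apply: all_closed_Var.
apply: definable_ext (definable_chain (ts := Zero :: rcons ts (Opp (last Zero ts))) _) _.
  by rewrite /= all_rcons cts /= closed_last.
move=> M e; rewrite /= map_rcons /= -last_map_eval.
by rewrite (_ : map (eval e) ts = mkseq e n) // /ts /mkseq -map_comp.
Qed.

Lemma definable_c_n_regular n : definable 0 (fun M _ => c_n_regular n M).
Proof.
apply: (definable_tuple (Q := fun M s => chain (czero :: s) -> divides_seq n s)).
apply: definable_imp (definable_divides n).
pose ts := mkseq Var n; have cts : all (closed_term n) ts by apply: all_closed_Var.
apply: definable_ext (definable_chain (ts := Zero :: ts) _) _ => // M e /=.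
by rewrite (_ : map (eval e) ts = mkseq e n) // /ts /mkseq -map_comp.
Qed.

Lemma definable_discrete : definable 0 (fun M _ => discrete M).
Proof.
apply: definable_or.
  exact: (definable_formula (f := All (Eq (Var 0) Zero))).
apply: (definable_ex (P := fun M e => e 0%N <> czero /\
    forall x : M, x <> czero -> x = e 0%N \/ cyc czero (e 0%N) x)).
apply: definable_and.
  exact: (definable_formula (f := Imp (Eq (Var 0) Zero) Bot)).
apply: (definable_all (P := fun M e => e 0%N <> czero ->
   e 0%N = e 1%N \/ cyc czero (e 1%N) (e 0%N))).
apply: definable_imp.
  exact: (definable_formula (f := Imp (Eq (Var 0) Zero) Bot)).
apply: definable_or; first exact: (definable_formula (f := Eq (Var 0) (Var 1))).
exact: (definable_formula (f := Cyc Zero (Var 1) (Var 0))).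
Qed.

Lemma definable_cyc_ordered : definable 0 (fun M _ => cyc_ordered_group M).
Proof.
(* Index 0 belongs to the innermost quantifier: three quantified elements read t, y, x in order, and
   four read u, t, y, x. *)
pose x := Var 0; pose y := Var 1; pose t := Var 2; pose u := Var 3.
have all1 f : closed_formula 1 f -> definable 0 (fun M e => holds e (All f)).
  by exists (All f).
have all2 f : closed_formula 2 f -> definable 0 (fun M e => holds e (All (All f))).
  by exists (All (All f)).
have all3 f : closed_formula 3 f -> definable 0 (fun M e => holds e (All (All (All f)))).
  by exists (All (All (All f))).
have all4 f : closed_formula 4 f ->
    definable 0 (fun M e => holds e (All (All (All (All f))))).
  by exists (All (All (All (All f)))).
pose Neq t1 t2 := Imp (Eq t1 t2) Bot.
pose d1 := all3 (Eq (Add t (Add y x)) (Add (Add t y) x)) isT.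
pose d2 := all2 (Eq (Add y x) (Add x y)) isT.
pose d3 := all1 (Eq (Add Zero x) x) isT.
pose d4 := all1 (Eq (Add (Opp x) x) Zero) isT.
pose d5 := all3 (Imp (Cyc t y x) (Neq t y)) isT.
pose d6 := all3 (Imp (Cyc t y x) (Neq y x)) isT.
pose d7 := all3 (Imp (Cyc t y x) (Neq t x)) isT.
pose d8 := all3 (Imp (Cyc t y x) (Cyc y x t)) isT.
pose d9 := all2 (Imp (Neq x y) (Imp (Cyc y x x) Bot)) isT.
pose d10 := all4 (Imp (Neq t u) (Imp (Neq y u) (Imp (Neq x u)
  (Imp (Cyc u t y) (Imp (Cyc u y x) (Cyc u t x)))))) isT.
pose d11 := all3 (Imp (Neq y t) (Imp (Neq x t) (Imp (Neq y x)
  (Imp (Imp (Cyc t y x) Bot) (Cyc t x y))))) isT.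
pose d12 := all4 (Imp (Cyc u t y) (Cyc (Add u x) (Add t x) (Add y x))) isT.
apply: definable_ext (definable_and d1 (definable_and d2 (definable_and d3
  (definable_and d4 (definable_and d5 (definable_and d6 (definable_and d7
  (definable_and d8 (definable_and d9 (definable_and d10 (definable_and d11
  d12))))))))))) _ => M e /=.
split=> [[a1 [a2 [a3 [a4 [a5 [a6 [a7 [a8 [a9 [a10 [a11 a12]]]]]]]]]]]|].
  split=> // [a b c abc|c]; first by split; [apply: a5 abc|apply: a6 abc|apply: a7 abc].
  split; [exact: (a9 c)|exact: (a10 c)|].
  move=> v w vc wc vw; have [p|np] := pselect (cyc c v w); first by left.
  by right; apply: a11.
move=> [a1 a2 a3 a4 a5 a6 a7 a8]; do ?split => //.
- by move=> a b c /a5[].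
- by move=> a b c /a5[].
- by move=> a b c /a5[].
- by move=> c; apply: (slo_irr (a7 c)).
- by move=> c; apply: (slo_trans (a7 c)).
- by move=> c v w vc wc vw nvw; have [] := slo_total (a7 c) vc wc vw.
Qed.

End Definability.

(** The theory consists of all sentences equivalent to some [P i], which avoids choosing a formula
    for each i. *)
Lemma elementary_definable (I : Type) (P : I -> cstruct -> Prop) :
  (forall i, definable 0 (fun M _ => P i M)) ->
  elementary (fun M => forall i, P i M).
Proof.
move=> dP; exists [set s : sentence | exists i, forall M, satisfies M s <-> P i M]%classic.
move=> M; split=> [h s [i sP]|h i]; first exact/sP.
have [f cf fP] := dP i.
have : satisfies M (exist _ f cf) by apply: h; exists i => N; apply: fP.
by move/fP.
Qed.

Lemma elementary_discrete_c_regular : elementary discrete_c_regular.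
Proof.
have [T TP] := elementary_definable (I := nat) (P := fun n M =>
  cyc_ordered_group M /\ discrete M /\ ((2 <= n)%N -> c_n_regular n M)) (fun n =>
  definable_and definable_cyc_ordered (definable_and definable_discrete
    (definable_guard (fun _ => definable_c_n_regular n)))).
exists T => M; rewrite -TP; split=> [[h1 h2 h3] n|h].
  by split=> //; split=> //; apply: h3.
by split; [exact: (h 0%N).1|exact: (h 0%N).2.1|move=> n; exact: (h n).2.2].
Qed.

Lemma elementary_discrete_regular : elementary discrete_regular.
Proof.
have [T TP] := elementary_definable (I := nat) (P := fun n M =>
  cyc_ordered_group M /\ discrete M /\ ((2 <= n)%N -> n_regular n M)) (fun n =>
  definable_and definable_cyc_ordered (definable_and definable_discrete
    (definable_guard (fun _ => definable_n_regular n)))).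
exists T => M; rewrite -TP; split=> [[h1 h2 h3] n|h].
  by split=> //; split=> //; apply: h3.
by split; [exact: (h 0%N).1|exact: (h 0%N).2.1|move=> n; exact: (h n).2.2].
Qed.

(** * Ultraproducts *)

Section Los.
Local Open Scope quotient_scope.
Variables (I : Type) (U : set_system I) (FU : UltraFilter U) (F : I -> cstruct).

Let Q : cstruct := ultraproduct FU F.
Let cls (f : forall i, F i) : Q := \pi_({eq_quot ultra_equiv FU F}) (f : {classic forall i, F i}).

Let UI (A B : set I) : U A -> U B -> U (A `&` B)%classic.
Proof. by move=> UA UB; apply: filterI. Qed.

Lemma cls_eq f g : cls f = cls g <-> U [set i | f i = g i]%classic.
Proof.
split=> [/eqmodP/asboolP//|fg]; apply/eqmodP; exact/asboolP.
Qed.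

(** The operations of the ultraproduct are computed on representatives, which agree with a given
    function only on a set of the ultrafilter. *)
Lemma repr_cls f : U [set i | repr (cls f : {eq_quot ultra_equiv FU F}) i = f i]%classic.
Proof. by apply/cls_eq; rewrite /cls reprK. Qed.

Lemma cls_surj (q : Q) : exists f, q = cls f.
Proof. by elim/quotW: q => f; exists f. Qed.

Lemma eval_ultraproduct (a : nat -> forall i, F i) t :
  eval (M := Q) (fun n => cls (a n)) t = cls (fun i => eval (fun n => a n i) t).
Proof.
elim: t => //= [t IH|t1 IH1 t2 IH2].
  have r := repr_cls (fun i => eval (fun n => a n i) t).
  by rewrite IH; apply/cls_eq; apply: filterS r => i e /=; rewrite e.
rewrite IH1 IH2; apply/cls_eq.
have r1 := repr_cls (fun i => eval (fun n => a n i) t1).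
have r2 := repr_cls (fun i => eval (fun n => a n i) t2).
by apply: filterS (UI r1 r2) => i [e1 e2] /=; rewrite e1 e2.
Qed.

(** This is the theorem of Los; maximality of the ultrafilter enters for [Imp] and [All]. *)
Lemma holds_ultraproduct f (a : nat -> forall i, F i) :
  holds (M := Q) (fun n => cls (a n)) f <-> U [set i | holds (fun n => a n i) f]%classic.
Proof.
elim: f a => [t1 t2|t1 t2 t3||f1 IH1 f2 IH2|f IH] a /=.
- by rewrite !eval_ultraproduct cls_eq.
- rewrite !eval_ultraproduct.
  have r1 := repr_cls (fun i => eval (fun n => a n i) t1).
  have r2 := repr_cls (fun i => eval (fun n => a n i) t2).
  have r3 := repr_cls (fun i => eval (fun n => a n i) t3).
  have r := UI r1 (UI r2 r3).
  by split=> h; have := UI r h; apply: filterS => i [[e1 [e2 e3]]] /=; rewrite e1 e2 e3.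
- by split=> // /filter_ex[].
- rewrite IH1 IH2; split=> [h|h h1]; last first.
    by have := UI h h1; apply: filterS => i [/= h2 /h2].
  have [/h U2|nU1] := in_ultra_setVsetC [set i | holds (fun n => a n i) f1]%classic FU.
    by apply: filterS U2 => i h2 _; apply: h2.
  by apply: filterS nU1 => i n1 /n1.
- have consE g : env_cons (cls g) (fun n => cls (a n)) = (fun n => cls (env_cons g a n)).
    by apply/funext => -[].
  have envE g i : (fun n => env_cons g a n i) = env_cons (g i) (fun n => a n i).
    by apply/funext => -[].
  split=> [h|h q]; last first.
    have [g ->] := cls_surj q; rewrite consE.
    by apply/IH; apply: filterS h => i /(_ (g i)) /=; rewrite envE.
  have [//|nU] := in_ultra_setVsetC
    [set i | forall x : F i, holds (env_cons x (fun n => a n i)) f]%classic FU.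
  (* A counterexample is chosen at each index where the universal statement fails, and [czero]
     elsewhere. *)
  have ex i : exists x : F i,
      ~ (forall x : F i, holds (env_cons x (fun n => a n i)) f) ->
      ~ holds (env_cons x (fun n => a n i)) f.
    by have [hx|/existsNP[x nx]] := pselect
      (forall x : F i, holds (env_cons x (fun n => a n i)) f); [exists czero|exists x].
  pose g i := sval (cid (ex i)).
  have := h (cls g); rewrite consE => /IH hg.
  have /filter_ex[i [/= n1]] := UI nU hg; rewrite envE.
  by have := svalP (cid (ex i)) => /(_ n1).
Qed.
End Los.

Lemma satisfies_ultraproduct (I : Type) (U : set_system I) (FU : UltraFilter U)
    (F : I -> cstruct) (s : sentence) :
  satisfies (ultraproduct FU F) s <-> U [set i | satisfies (F i) s]%classic.
Proof. exact: (holds_ultraproduct FU (val s) (fun _ _ => czero)). Qed.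

(** * Isomorphism, elementary equivalence and elementary classes *)

Lemma isomorphic_holds (G H : cstruct) (f : G -> H) : bijective f ->
  f czero = czero -> (forall x, f (copp x) = copp (f x)) ->
  (forall x y, f (cadd x y) = cadd (f x) (f y)) ->
  (forall x y z, cyc x y z <-> cyc (f x) (f y) (f z)) ->
  forall phi (e : nat -> G), holds e phi <-> holds (f \o e) phi.
Proof.
move=> bf f0 fN fD fR; have evE t e : f (eval e t) = eval (f \o e) t.
  by elim: t => //= [t <-|t1 <- t2 <-].
elim=> [t1 t2|t1 t2 t3||p IHp q IHq|p IHp] e //=.
- by rewrite -!evE; split=> [->//|/(bij_inj bf)].
- by rewrite -!evE.
- by rewrite IHp IHq.
have consE x : f \o env_cons x e = env_cons (f x) (f \o e).
  by apply/funext => -[].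
split=> h x; last by apply/IHp; rewrite consE.
by have [g _ gK] := bf; rewrite -(gK x) -consE; apply/IHp.
Qed.

Lemma isomorphic_elem_equiv (G H : cstruct) : isomorphic G H -> elem_equiv G H.
Proof.
move=> [f [bf f0 fN fD fR]] s; rewrite /satisfies (isomorphic_holds bf) //.
by rewrite (_ : f \o _ = fun=> czero) //; apply/funext.
Qed.

Lemma isomorphic_refl (G : cstruct) : isomorphic G G.
Proof. by exists id; split=> //; exists id. Qed.

Lemma elementary_equiv (K : cstruct -> Prop) (G H : cstruct) :
  elementary K -> elem_equiv G H -> K H -> K G.
Proof. by move=> [T TK] GH /TK KH; apply/TK => s /KH/GH. Qed.

Lemma chart_elementary (K : cstruct -> Prop) (G : cstruct) : elementary K ->
  (forall m, K (cycZn m)) -> has_zgroup_chart G -> K G.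
Proof.
move=> [T TK] Kfin [M [pos [one [z [rep [Mz Gc z0]]]]]]; apply/TK => s Ts.
by apply: (satisfies_zgroup Mz Gc z0) => m; have /TK := Kfin m; apply.
Qed.

Definition formula_not (f : formula) : formula := Imp f Bot.

Lemma sentence_not_subproof (s : sentence) : closed_formula 0 (formula_not (val s)).
Proof. by rewrite /= (valP s). Qed.

Definition sentence_not (s : sentence) : sentence :=
  exist (closed_formula 0) _ (sentence_not_subproof s).

Lemma sentence_and_subproof (s t : sentence) :
  closed_formula 0 (formula_not (Imp (val s) (formula_not (val t)))).
Proof. by rewrite /= (valP s) (valP t). Qed.

Definition sentence_and (s t : sentence) : sentence :=
  exist (closed_formula 0) _ (sentence_and_subproof s t).

Lemma satisfies_not (G : cstruct) s : satisfies G (sentence_not s) <-> ~ satisfies G s.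
Proof. by []. Qed.

Lemma satisfies_and (G : cstruct) s t :
  satisfies G (sentence_and s t) <-> satisfies G s /\ satisfies G t.
Proof.
split=> [h|[hs ht] /(_ hs ht)//].
by split; apply: contrapT => n; apply: h => // hs.
Qed.

(** For a sentence true in G, the set of m at which Z/(m+1)Z satisfies it is not empty, as otherwise
    the negation would pass to G. Conjunctions make these sets a filter base, and any ultrafilter
    above it works. *)
Lemma chart_ultraproduct (G : cstruct) : has_zgroup_chart G ->
  exists (I : Type) (U : set_system I) (FU : UltraFilter U) (F : I -> cstruct),
    (forall i, finite_cyclic (F i)) /\ elem_equiv G (ultraproduct FU F).
Proof.
move=> [M [pos [one [z [rep [Mz Gc z0]]]]]].
pose mods s := [set m | satisfies (cycZn m) s]%classic.
pose B := filter_from [set s | satisfies G s]%classic mods.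
have PB : ProperFilter B.
  apply: filter_from_proper => [|s Gs]; last first.
    apply: contrapT => n0.
    have : satisfies G (sentence_not s).
      apply: (satisfies_zgroup Mz Gc z0) => m; apply/satisfies_not => ms.
      by apply: n0; exists m.
    by move/satisfies_not; apply.
  apply: filter_from_filter.
    by exists (exist (closed_formula 0) (Imp Bot Bot) isT).
  move=> s t Gs Gt; exists (sentence_and s t); first exact/satisfies_and.
  by move=> m /satisfies_and[].
have [U [FU BU]] := ultraFilterLemma PB.
exists nat, U, FU, cycZn; split=> [m|s]; first by exists m; apply: isomorphic_refl.
rewrite satisfies_ultraproduct; split=> [Gs|Us]; first by apply: BU; exists s.
apply: contrapT => /satisfies_not Gns.
have Uns : U (mods (sentence_not s)) by apply: BU; exists (sentence_not s).
have : U (mods s `&` mods (sentence_not s))%classic by apply: filterI.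
by move=> /filter_ex[m [ms /satisfies_not]].
Qed.

Theorem theorem4p35 :
  smallest_elementary discrete_c_regular finite_cyclic /\
  (smallest_elementary discrete_regular cyclic /\
   forall G : cstruct, discrete_regular G ->
     (linearly_cyc_ordered G /\ elem_equiv G cycZ) \/
     (c_regular G /\
      exists (I : Type) (U : set_system I) (FU : UltraFilter U)
             (F : I -> cstruct),
        (forall i, finite_cyclic (F i)) /\
        elem_equiv G (ultraproduct FU F))).
Proof.
split; [split|split; [split|]].
- exact: elementary_discrete_c_regular.
- move=> G [m /isomorphic_elem_equiv Gm].
  exact: elementary_equiv elementary_discrete_c_regular Gm (discrete_c_regular_cycZn m).
- move=> K Kel Kfin G /discrete_c_regular_chart; apply: chart_elementary => // m.
  by apply: Kfin; exists m; apply: isomorphic_refl.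
- exact: elementary_discrete_regular.
- exact: cyclic_discrete_regular.
- move=> K Kel Kcyc G /discrete_regular_chart[[_ Gz]|].
    exact: elementary_equiv Kel Gz (Kcyc _ cyclic_cycZ).
  by apply: chart_elementary => // m; apply: Kcyc; apply: cyclic_cycZn.
move=> G /discrete_regular_chart[|Gc]; [by left|right; split].
  (* c-regularity is not extracted from regularity by computation: it is part of an elementary class
     containing all Z/nZ, hence passes to G. *)
  have [] := chart_elementary elementary_discrete_c_regular discrete_c_regular_cycZn Gc.
  by [].
exact: chart_ultraproduct.
Qed.
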